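(* Let $n\in\{2,3\}$, let $D\subset\mathbb{R}^n$ be a domain, $I\subset\mathbb{R}$ an open time interval, and let $\varphi=(\varphi_1,\dots,\varphi_n):D\times I\to\mathbb{R}^n$ and $\rho:D\times I\to\mathbb{R}$ be smooth. Let $\nabla$ and $d\varphi$ denote derivatives with respect to $z\in D$, let a prime denote the time derivative, and let $\int\varphi_n\,dt$ denote any fixed smooth function on $D\times I$ whose time derivative is $\varphi_n$. Define $$h=\sum_{i=1}^2\det(\nabla\varphi_i',\nabla\varphi_i)+\det\Big(\nabla\rho,\nabla\int\varphi_2\,dt\Big)\quad\text{if } n=2,$$ $$h=\sum_{i=1}^3\nabla\varphi_i'\times\nabla\varphi_i+\nabla\rho\times\nabla\int\varphi_3\,dt\quad\text{if } n=3.$$ Then $(\varphi,\rho)$ provides a solution to the Euler--Boussinesq equations if and only if $\det(d\varphi)\neq0$ everywhere in $D\times I$ and $\det(d\varphi)$, $\rho$ and $h$ are all independent of time.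
   Context: The pressure-eliminated Euler--Boussinesq equations for a velocity field $u(x,t)\in\mathbb{R}^n$ and a rescaled density $\varrho(x,t)\in\mathbb{R}$ are $$\nabla\cdot u=0,\qquad \operatorname{curl}\big(u_t+(u\cdot\nabla)u+\varrho\, e_n\big)=0,\qquad \varrho_t+\langle u,\nabla\varrho\rangle=0,$$ where $e_n$ is the (vertical) last standard unit vector and, for $n=2$, $\operatorname{curl}F=\partial_1F_2-\partial_2F_1$. (The rescaled density absorbs the gravitational constant $g$: e.g. $\varrho=g\tilde\rho/\overline\rho$ with $\tilde\rho$ the density and $\overline\rho$ the average density.) A pair $(\varphi,\rho)$ of smooth maps on $D\times I$ provides a solution to the Euler--Boussinesq equations if $\det(d\varphi)\ne0$ everywhere and the fields $u,\varrho$ determined by $$\frac{\partial}{\partial t}\varphi(z,t)=u(\varphi(z,t),t),\qquad \rho(z,t)=\varrho(\varphi(z,t),t)$$ satisfy the three equations $\nabla\cdot u=0$, $\operatorname{curl}\big(u_t+(u\cdot\nabla)u+\varrho\, e_n\big)=0$ and $\varrho_t+\langle u,\nabla\varrho\rangle=0$. If the maps $\varphi^t=\varphi(\cdot,t)$ are diffeomorphisms onto their images, then $u,\varrho$ are globally defined; in general they are understood locally, i.e. on the images of neighbourhoods $W\times J\subset D\times I$ of each point on which every $\varphi^t$, $t\in J$, is injective. *)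

(* Defs.v *)
From HB Require Import structures.
From mathcomp Require Import all_boot all_order all_algebra.
From mathcomp Require Import all_classical all_reals all_analysis.

Set Implicit Arguments.
Unset Strict Implicit.
Unset Printing Implicit Defensive.

Import Order.TTheory GRing.Theory Num.Theory.
Import numFieldNormedType.Exports.

Local Open Scope classical_set_scope.
Local Open Scope ring_scope.

(* A point z of R^n is a row vector 'rV[R]_n, so the coordinates 1, ..., n of
   the mathematical text are the indices 0, ..., n-1 here.  A function of space
   and time is curried, z before t; f^~ t is its restriction to time t. *)

(* C^oo on the open set U: all iterated directional derivatives exist and are
   continuous on U.  In finite dimension this is the same as asking it for the
   iterated partial derivatives only. *)
Definition iter_derive (R : realType) (V W : normedModType R)
    (vs : seq V) (f : V -> W) : V -> W :=
  foldr (fun v g => 'D_v g) f vs.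

Definition smooth_on (R : realType) (V W : normedModType R)
    (U : set V) (f : V -> W) : Prop :=
  forall (vs : seq V) (x : V), U x ->
    {for x, continuous (iter_derive vs f)} /\
    forall v : V, derivable (iter_derive vs f) x v.

Definition smooth_on_spacetime (R : realType) (n : nat) (W : normedModType R)
    (D : set 'rV[R]_n) (I : set R) (f : 'rV[R]_n -> R -> W) : Prop :=
  smooth_on (D `*` I) (fun p : 'rV[R]_n * R => f p.1 p.2).

Definition domain (R : realType) (n : nat) (D : set 'rV[R]_n) : Prop :=
  [/\ D !=set0, open D & connected D].

Definition open_interval (R : realType) (I : set R) : Prop :=
  [/\ I !=set0, open I & is_interval I].

Definition time_independent (R : realType) (n : nat) (T : Type)
    (D : set 'rV[R]_n) (I : set R) (f : 'rV[R]_n -> R -> T) : Prop :=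
  forall z, D z -> forall s t, I s -> I t -> f z s = f z t.

Definition basis_vec (R : realType) (n : nat) (i : 'I_n) : 'rV[R]_n :=
  delta_mx 0 i.
Arguments basis_vec R {n} i.

Definition partial (R : realType) (n : nat) (W : normedModType R) (i : 'I_n)
    (f : 'rV[R]_n -> W) : 'rV[R]_n -> W :=
  'D_(basis_vec R i) f.

Definition dt (R : realType) (n : nat) (W : normedModType R)
    (f : 'rV[R]_n -> R -> W) : 'rV[R]_n -> R -> W :=
  fun z t => derive1 (f z) t.

Definition coord (R : realType) (n : nat) (i : 'I_n)
    (F : 'rV[R]_n -> R -> 'rV[R]_n) : 'rV[R]_n -> R -> R :=
  fun z t => F z t 0 i.

Definition grad (R : realType) (n : nat) (f : 'rV[R]_n -> R) (z : 'rV[R]_n) :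
    'rV[R]_n :=
  \row_i partial i f z.

Definition dotv (R : realType) (n : nat) (a b : 'rV[R]_n) : R :=
  \sum_i a 0 i * b 0 i.

Definition div (R : realType) (n : nat) (F : 'rV[R]_n -> 'rV[R]_n)
    (x : 'rV[R]_n) : R :=
  \sum_i partial i (fun y => F y 0 i) x.

Definition det2 (R : realType) (a b : 'rV[R]_2) : R :=
  \det (col_mx a b : 'M[R]_2).

Definition row3 (R : realType) (a b c : R) : 'rV[R]_3 :=
  \row_i nth 0 [:: a; b; c] i.

Definition cross (R : realType) (a b : 'rV[R]_3) : 'rV[R]_3 :=
  let p := fun k : nat => a 0 (inord k) in
  let q := fun k : nat => b 0 (inord k) in
  row3 (p 1%N * q 2%N - p 2%N * q 1%N)
       (p 2%N * q 0%N - p 0%N * q 2%N)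
       (p 0%N * q 1%N - p 1%N * q 0%N).

Definition curl2 (R : realType) (F : 'rV[R]_2 -> 'rV[R]_2) (x : 'rV[R]_2) : R :=
  let d := fun i j : nat => partial (inord i) (fun y => F y 0 (inord j)) x in
  d 0%N 1%N - d 1%N 0%N.

Definition curl3 (R : realType) (F : 'rV[R]_3 -> 'rV[R]_3) (x : 'rV[R]_3) :
    'rV[R]_3 :=
  let d := fun i j : nat => partial (inord i) (fun y => F y 0 (inord j)) x in
  row3 (d 1%N 2%N - d 2%N 1%N)
       (d 2%N 0%N - d 0%N 2%N)
       (d 0%N 1%N - d 1%N 0%N).

(* (u . grad) u at time t *)
Definition convection (R : realType) (n : nat) (u : 'rV[R]_n -> R -> 'rV[R]_n)
    (x : 'rV[R]_n) (t : R) : 'rV[R]_n :=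
  \sum_i u x t 0 i *: partial i (u^~ t) x.

(* The dimension is n.+1 so that the vertical vector e_n is the basis vector of
   index ord_max.  The parameter curl is curl2 or curl3. *)
Definition euler_boussinesq_at (R : realType) (n : nat) (V : zmodType)
    (curl : ('rV[R]_n.+1 -> 'rV[R]_n.+1) -> 'rV[R]_n.+1 -> V)
    (u : 'rV[R]_n.+1 -> R -> 'rV[R]_n.+1) (vrho : 'rV[R]_n.+1 -> R -> R)
    (x : 'rV[R]_n.+1) (t : R) : Prop :=
  [/\ div (u^~ t) x = 0,
      curl (fun y => dt u y t + convection u y t
                     + vrho y t *: basis_vec R ord_max) x = 0
    & dt vrho x t + dotv (u x t) (grad (vrho^~ t) x) = 0].

(* u and vrho are the Eulerian fields of (phi, rho) over W x J.  They are total
   functions, but only their values on the image {(phi z t, t)} are prescribed,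
   and only these matter. *)
Definition determines_fields (R : realType) (n : nat)
    (phi : 'rV[R]_n -> R -> 'rV[R]_n) (rho : 'rV[R]_n -> R -> R)
    (W : set 'rV[R]_n) (J : set R)
    (u : 'rV[R]_n -> R -> 'rV[R]_n) (vrho : 'rV[R]_n -> R -> R) : Prop :=
  forall z t, W z -> J t ->
    dt phi z t = u (phi z t) t /\ rho z t = vrho (phi z t) t.

(* The fields are understood locally, on the images of the open boxes W x J on
   which every phi^t is injective; on such a box they exist and are unique.
   For smooth (phi, rho) with det (d phi) <> 0, every point of D x I lies in
   such a box, the image is open in space-time and the fields are smooth on it
   (inverse function theorem), so all derivatives in the equations exist.
   If every phi^t is injective on D, then W = D, J = I is one of the boxes. *)
Definition provides_solution (R : realType) (n : nat) (V : zmodType)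
    (curl : ('rV[R]_n.+1 -> 'rV[R]_n.+1) -> 'rV[R]_n.+1 -> V)
    (D : set 'rV[R]_n.+1) (I : set R)
    (phi : 'rV[R]_n.+1 -> R -> 'rV[R]_n.+1) (rho : 'rV[R]_n.+1 -> R -> R) :
    Prop :=
  (forall z t, D z -> I t -> \det ('J (phi^~ t) z) != 0) /\
  (forall (W : set 'rV[R]_n.+1) (J : set R),
     open W -> W `<=` D -> open J -> J `<=` I ->
     (forall t, J t -> {in W &, injective (phi^~ t)}) ->
     forall (u : 'rV[R]_n.+1 -> R -> 'rV[R]_n.+1) (vrho : 'rV[R]_n.+1 -> R -> R),
     determines_fields phi rho W J u vrho ->
     forall z t, W z -> J t -> euler_boussinesq_at curl u vrho (phi z t) t).

(* In h2 and h3, intphi is a time antiderivative of the last component of phi. *)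
Definition h2 (R : realType) (phi : 'rV[R]_2 -> R -> 'rV[R]_2)
    (rho intphi : 'rV[R]_2 -> R -> R) (z : 'rV[R]_2) (t : R) : R :=
  \sum_(i < 2) det2 (grad ((dt (coord i phi))^~ t) z) (grad ((coord i phi)^~ t) z)
  + det2 (grad (rho^~ t) z) (grad (intphi^~ t) z).

Definition h3 (R : realType) (phi : 'rV[R]_3 -> R -> 'rV[R]_3)
    (rho intphi : 'rV[R]_3 -> R -> R) (z : 'rV[R]_3) (t : R) : 'rV[R]_3 :=
  \sum_(i < 3) cross (grad ((dt (coord i phi))^~ t) z) (grad ((coord i phi)^~ t) z)
  + cross (grad (rho^~ t) z) (grad (intphi^~ t) z).

Definition last_antiderivative (R : realType) (n : nat) (D : set 'rV[R]_n.+1)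
    (I : set R) (phi : 'rV[R]_n.+1 -> R -> 'rV[R]_n.+1)
    (intphi : 'rV[R]_n.+1 -> R -> R) : Prop :=
  smooth_on_spacetime D I intphi /\
  forall z t, D z -> I t -> dt intphi z t = coord ord_max phi z t.

(* Main.v *)
Require Import Defs.
From HB Require Import structures.
From mathcomp Require Import all_boot all_order all_algebra.
From mathcomp Require Import all_classical all_reals all_analysis.
From mathcomp Require Import perm ring lra.
Import Order.TTheory GRing.Theory Num.Theory.
Import numFieldNormedType.Exports.
Local Open Scope classical_set_scope.
Local Open Scope ring_scope.
Set Implicit Arguments.
Unset Strict Implicit.
Unset Printing Implicit Defensive.

(** Write M for the Jacobian matrix of phi at (z, t), with M_ij = d_i phi_j, and
    F = u_t + (u . grad) u + vrho e_n for the force whose curl is taken.  The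
    Eulerian fields are linked to material quantities by identities of the form
    g (phi (z, t), t) = G (z, t), and the chain rule turns each equation at the
    point phi (z, t) into a statement at (z, t):

    - the velocity gradient U satisfies M' = M U, so Jacobi's formula gives
      (det M)' = det M * div u;
    - rho' is the material derivative vrho_t + u . grad vrho;
    - the force along trajectories is phi'' + rho e_n, so the matrix of its
      material derivatives d_i (phi_j'' + rho delta_jn) is M K, with K the
      Eulerian gradient of F.

    For the curl, let H_ab be the sum over j of the 2 x 2 minors of rows a, b of
    (grad phi_j', grad phi_j), plus the same minor of (grad rho, grad int phi_n).
    This antisymmetric matrix is h in disguise: in dimension 2 its one entry is
    h, in dimension 3 its three entries are the components of h.  If rho' = 0,
    then differentiating in time, with d_t int phi_n = phi_n and the minors of
    (grad phi_j', grad phi_j') vanishing, gives H' = M (K - K^T) M^T.  As M is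
    invertible, H' = 0 exactly when K is symmetric, that is when curl F = 0.
    So the three equations along a trajectory say that det M, rho and H have
    zero time derivative there [euler_boussinesq_atP, is_derive_vorticity_form],
    and the criterion [solution_criterion] holds in every dimension.

    The analytic content is that the Eulerian fields, given only implicitly, are
    differentiable, and that boxes on which every phi^t is injective exist around
    every point.  Both come from strict differentiability: by the mean value
    theorem the increments of phi over a small box are uniformly close to those
    of its differential, so z |-> z + (y - phi (z, t)) M^-1 is a contraction.
    Its fixed points solve phi (z, t) = y with a Lipschitz bound on z
    [local_section], which is all that is needed to differentiate g at
    phi (z, t) [eulerian_chain].  The exchange of d_t and d_i is the
    symmetry of second derivatives [derive_commute]. *)

(** * Strict differentiability from directional derivatives *)

Lemma is_derive_line (R : realType) (V W : normedModType R) (f : V -> W)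
    (x v : V) (c : R) :
  derivable f (x + c *: v) v ->
  is_derive c 1 (fun h : R => f (x + h *: v)) ('D_v f (x + c *: v)).
Proof.
move=> df.
have E : (fun h : R => h^-1 *: (f (x + (h%:A + c) *: v) - f (x + c *: v)))
       = (fun h : R => h^-1 *: (f (h *: v + (x + c *: v)) - f (x + c *: v))).
  by apply/funext => h; rewrite [h%:A]mulr1 scalerDl addrCA.
by apply: DeriveDef; rewrite /derivable /derive /= E.
Qed.

Lemma mvt_line (R : realType) (V : normedModType R) (f : V -> R) (x v : V) (a : R) :
  (forall c, `|c| <= `|a| -> derivable f (x + c *: v) v) ->
  exists2 c, `|c| <= `|a| & f (x + a *: v) - f x = a * 'D_v f (x + c *: v).
Proof.
move=> df.
have cont i : (forall c, c \in i -> `|c| <= `|a|) ->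
    {within [set` i : interval R], continuous (fun h : R => f (x + h *: v))}.
  move=> iP; apply: derivable_within_continuous => c ci.
  by have [] := is_derive_line (df c (iP c ci)).
have [a0|a0|->] := ltrgtP a 0; last by exists 0; rewrite ?scale0r ?addr0 ?subrr ?mul0r.
- have iP c : c \in `[a, 0] -> `|c| <= `|a|.
    rewrite in_itv /= => /andP[ac c0].
    by rewrite (ltr0_norm a0) (ler0_norm c0) lerN2.
  have [c cI E] := @MVT R _ (fun c => 'D_v f (x + c *: v)) a 0 a0
    (fun c cI => is_derive_line (df c (iP c (subset_itv_oo_cc cI)))) (cont _ iP).
  exists c; first by apply: iP; exact: subset_itv_oo_cc.
  move: E; rewrite scale0r addr0 => E.
  by rewrite -opprB E sub0r mulrN opprK mulrC.
- have iP c : c \in `[0, a] -> `|c| <= `|a|.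
    rewrite in_itv /= => /andP[c0 ca].
    by rewrite (gtr0_norm a0) (ger0_norm c0).
  have [c cI E] := @MVT R _ (fun c => 'D_v f (x + c *: v)) 0 a a0
    (fun c cI => is_derive_line (df c (iP c (subset_itv_oo_cc cI)))) (cont _ iP).
  exists c; first by apply: iP; exact: subset_itv_oo_cc.
  by move: E; rewrite scale0r addr0 subr0 mulrC => E.
Qed.

(** The increment along a combination of the directions b k is split into steps
    along one direction at a time.  The mean value theorem applies to each step,
    and continuity of 'D_(b k) f at p makes the error uniform in the base point q. *)
Lemma strict_estimate_family (R : realType) (V : normedModType R) (T : Type) (s : seq T)
    (b : T -> V) (f : V -> R) (p : V) :
  (forall k, \forall x \near p, derivable f x (b k)) ->
  (forall k, {for p, continuous ('D_(b k) f)}) ->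
  forall e, 0 < e -> \forall r \near 0^'+, forall q (a : T -> R),
    `|q - p| < r -> (forall k, `|a k| < r) ->
    `|f (q + \sum_(k <- s) a k *: b k) - f q - \sum_(k <- s) a k * 'D_(b k) f p|
      <= e * \sum_(k <- s) `|a k|.
Proof.
move=> df cf e e0; elim: s => [|k s IH].
  by near=> r => q a _ _; rewrite !big_nil addr0 !subrr normr0 mulr0.
have /nbhs_ballP[d /= d0 dP] : \forall x \near p,
    derivable f x (b k) /\ `|'D_(b k) f p - 'D_(b k) f x| <= e.
  apply: filterI; first exact: df.
  exact: (@cvgrPdist_le _ _ _ _ _ _ _).1 (cf k) e e0.
(* All intermediate points of the path lie within r * B of p. *)
pose B := 1 + \sum_(j <- k :: s) `|b j|.
have B0 : 0 < B by rewrite ltr_pwDl ?sumr_ge0.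
near=> r => q a qr ar.
have r0 : 0 < r by [].
have rB : r * B < d.
  by rewrite -ltr_pdivlMr //; near: r; apply: nbhs_right_lt; rewrite divr_gt0.
rewrite !big_cons.
set S := \sum_(j <- s) a j *: b j.
have bS c : `|c| <= `|a k| -> ball p d (q + S + c *: b k).
  move=> ca; rewrite -ball_normE /= distrC.
  apply: (le_lt_trans _ rB).
  rewrite /B big_cons mulrDr mulr1 mulrDr.
  rewrite (_ : q + S + c *: b k - p = (q - p) + (c *: b k + S)); last first.
    by rewrite addrAC [q + S - p]addrAC -!addrA [S + _]addrC.
  apply: (le_trans (ler_normD _ _)); apply: lerD; first exact: ltW.
  apply: (le_trans (ler_normD _ _)); apply: lerD.
    by rewrite normrZ ler_wpM2r // (le_trans ca) // ltW.
  rewrite mulr_sumr; apply: (le_trans (ler_norm_sum _ _ _)).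
  by apply: ler_sum => j _; rewrite normrZ ler_wpM2r // ltW.
have [c ca E] := mvt_line (fun c ca => (dP _ (bS c ca)).1).
rewrite [a k *: b k + S]addrC addrA.
set g := f (q + S + a k *: b k) in E *.
rewrite (_ : g - f q - _ = (g - f (q + S) - a k * 'D_(b k) f p) +
  (f (q + S) - f q - \sum_(j <- s) a j * 'D_(b j) f p)); last by ring.
apply: (le_trans (ler_normD _ _)); rewrite mulrDr; apply: lerD.
  rewrite E -mulrBr normrM mulrC ler_wpM2r // distrC.
  by have [_] := dP _ (bS c ca).
suff: forall q (a : T -> R), `|q - p| < r -> (forall k, `|a k| < r) ->
    `|f (q + \sum_(k <- s) a k *: b k) - f q - \sum_(k <- s) a k * 'D_(b k) f p|
      <= e * \sum_(k <- s) `|a k| by apply.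
by near: r.
Unshelve. all: by end_near. Qed.

Lemma bounded_linear_cts (R : realType) (V W : normedModType R)
    (L : {linear V -> W}) (k : R) :
  (forall v, `|L v| <= k * `|v|) -> continuous L.
Proof.
move=> Lk; apply/linear_bounded_continuous/linear_boundedP.
near=> r => v; apply: (le_trans (Lk v)); apply: ler_wpM2r => //.
Unshelve. all: by end_near. Qed.

(** Epsilon form of differentiability, in which it is obtained both for smooth
    functions and for fields transported along the flow. *)
Lemma is_diff_estimate (R : realType) (V W : normedModType R) (f : V -> W)
    (L : {linear V -> W}) (p : V) : continuous L ->
  is_diff p f L <->
  (forall e, 0 < e -> \forall q \near p, `|f q - f p - L (q - p)| <= e * `|q - p|).
Proof.
move=> cL.
have E : (f \o shift p = cst (f p) + L +o_ 0 id) <->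
  (forall e, 0 < e -> \forall q \near p, `|f q - f p - L (q - p)| <= e * `|q - p|).
  split=> [/eqaddoP h e e0|h].
    have /nbhs_ballP[d /= d0 dP] := h e e0.
    apply/nbhs_ballP; exists d => //= q; rewrite -ball_normE /= => pq.
    have /dP : ball 0 d (q - p) by rewrite -ball_normE /= sub0r opprB.
    by rewrite !fctE /= subrK opprD addrA.
  apply/eqaddoP => e e0; have /nbhs_ballP[d /= d0 dP] := h e e0.
  apply/nbhs_ballP; exists d => //= q; rewrite -ball_normE /= sub0r => pq.
  have /dP : ball p d (q + p) by rewrite -ball_normE /= opprD addrCA subrr addr0.
  by rewrite !fctE /= addrK opprD addrA.
split=> [[df dL]|/E h].
  apply/E; have /diff_locallyP[_ ->] := df.
  by rewrite dL.
have dL := diff_unique cL h.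
by split=> //; apply/diff_locallyP; rewrite dL.
Qed.

(** The two-point form of the derivative: q' is not tied to p.  This is what makes
    local injectivity and the contraction estimate uniform. *)
Definition strict_derivative (R : realType) (V W : normedModType R)
    (f L : V -> W) (p : V) : Prop :=
  forall e, 0 < e -> \forall r \near 0^'+, forall q q',
    `|q - p| < r -> `|q' - p| < r ->
    `|f q - f q' - L (q - q')| <= e * `|q - q'|.

Lemma strict_is_diff (R : realType) (V W : normedModType R) (f : V -> W)
    (L : {linear V -> W}) (p : V) :
  continuous L -> strict_derivative f L p -> is_diff p f L.
Proof.
move=> cL sf; apply/is_diff_estimate => // e e0.
have [r r0 rP] : exists2 r : R, 0 < r & forall q q',
    `|q - p| < r -> `|q' - p| < r ->
    `|f q - f q' - L (q - q')| <= e * `|q - q'|.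
  near (0 : R)^'+ => r; exists r => //.
  by near: r; exact: sf.
apply/nbhs_ballP; exists r => //= q; rewrite -ball_normE /= distrC => qr.
by apply: rP => //; rewrite subrr normr0.
Unshelve. all: by end_near. Qed.

Lemma ler_coord_norm (R : realType) m n (A : 'M[R]_(m, n)) i j :
  `|A i j| <= `|A|.
Proof.
rewrite [leRHS]/Num.Def.normr /= mx_normrE.
exact: (le_bigmax _ (fun ij => `|A ij.1 ij.2|) (i, j)).
Qed.

Lemma ler_mx_norm (R : realType) m n (A : 'M[R]_(m, n)) (e : R) :
  0 <= e -> (forall i j, `|A i j| <= e) -> `|A| <= e.
Proof.
move=> e0 Ae; rewrite [leLHS]/Num.Def.normr /= mx_normrE.
by apply: bigmax_le.
Qed.

Lemma strict_derivative_mx (R : realType) (V : normedModType R) m n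
    (f L : V -> 'M[R]_(m, n)) (p : V) :
  (forall i j, strict_derivative (fun q => f q i j) (fun q => L q i j) p) ->
  strict_derivative f L p.
Proof.
move=> sf e e0.
have : \forall r \near 0^'+, forall i j q q',
    `|q - p| < r -> `|q' - p| < r ->
    `|f q i j - f q' i j - L (q - q') i j| <= e * `|q - q'|.
  by apply: filter_forall => i; apply: filter_forall => j; exact: sf.
apply: filterS => r rP q q' qr q'r; apply: ler_mx_norm.
  by rewrite mulr_ge0 // ltW.
by move=> i j; rewrite !mxE; exact: rP.
Qed.

(** Directions of space-time are indexed by option 'I_n, with None for time, so that
    a single sum covers space and time. *)
Definition st_basis (R : realType) n (k : option 'I_n) : 'rV[R]_n * R :=
  if k is Some i then (basis_vec R i, 0) else (0, 1).

Definition st_coord (R : realType) n (v : 'rV[R]_n * R) (k : option 'I_n) : R :=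
  if k is Some i then v.1 0 i else v.2.

Lemma sum_option (M : nmodType) (n : nat) (F : option 'I_n -> M) :
  \sum_k F k = F None + \sum_i F (Some i).
Proof.
rewrite (bigD1 None) //=; congr (_ + _).
rewrite (reindex_omap Some id) /=; last by case.
by apply: eq_bigl => i; rewrite eqxx.
Qed.

Lemma st_decomp (R : realType) n (v : 'rV[R]_n * R) :
  v = \sum_k st_coord v k *: st_basis R k.
Proof.
case: v => v s; rewrite sum_option /=.
have -> : \sum_i v 0 i *: ((basis_vec R i, 0) : 'rV[R]_n * R) = (v, 0).
  rewrite [in RHS](row_sum_delta v).
  elim/big_rec2: _ => [|i x y _ ->] //.
  by congr pair; rewrite /= ?scaler0 ?addr0.
by congr pair; rewrite /= ?scaler0 ?add0r ?addr0 // [_%:A]mulr1.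
Qed.

Lemma ler_st_coord (R : realType) n (v : 'rV[R]_n * R) k : `|st_coord v k| <= `|v|.
Proof.
case: v k => v s [i|]; rewrite prod_normE /= le_max ?lexx ?orbT //.
by rewrite ler_coord_norm.
Qed.

(** * Smooth functions of space and time *)

(** The candidate for the differential at p, built from partial derivatives so that
    it is linear and continuous before differentiability is known. *)
Definition st_diff (R : realType) n (W : normedModType R)
    (f : 'rV[R]_n * R -> W) (p v : 'rV[R]_n * R) : W :=
  \sum_k st_coord v k *: 'D_(st_basis R k) f p.

Lemma st_diff_linear (R : realType) n (W : normedModType R)
    (f : 'rV[R]_n * R -> W) (p : 'rV[R]_n * R) : linear (st_diff f p).
Proof.
move=> a u v; rewrite /st_diff scaler_sumr -big_split /=.
apply: eq_bigr => k _; rewrite scalerA -scalerDl; congr (_ *: _).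
by case: k => [i|] //=; rewrite !mxE.
Qed.

HB.instance Definition _ (R : realType) n (W : normedModType R)
    (f : 'rV[R]_n * R -> W) (p : 'rV[R]_n * R) :=
  GRing.isLinear.Build R _ _ _ (st_diff f p) (@st_diff_linear R n W f p).

Lemma st_diff_continuous (R : realType) n (W : normedModType R)
    (f : 'rV[R]_n * R -> W) (p : 'rV[R]_n * R) : continuous (st_diff f p).
Proof.
apply: (@bounded_linear_cts _ _ _ _ (\sum_k `|'D_(st_basis R k) f p|)) => v.
rewrite mulr_suml; apply: (le_trans (ler_norm_sum _ _ _)).
apply: ler_sum => k _; rewrite normrZ mulrC ler_wpM2l //.
exact: ler_st_coord.
Qed.

Lemma smooth_derivable (R : realType) (V W : normedModType R) (U : set V)
    (f : V -> W) x v : smooth_on U f -> U x -> derivable f x v.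
Proof. by move=> sf Ux; have [_] := sf [::] x Ux; exact. Qed.

Lemma smooth_continuous (R : realType) (V W : normedModType R) (U : set V)
    (f : V -> W) x : smooth_on U f -> U x -> {for x, continuous f}.
Proof. by move=> sf Ux; have [] := sf [::] x Ux. Qed.

Lemma smooth_derive (R : realType) (V W : normedModType R) (U : set V)
    (f : V -> W) v : smooth_on U f -> smooth_on U ('D_v f).
Proof.
move=> sf vs x Ux; have := sf (rcons vs v) x Ux.
by rewrite /iter_derive foldr_rcons.
Qed.

(** Apply the estimate for families to the increment q - q', decomposed in the
    standard basis of space-time. *)
Lemma smooth_strict_scalar (R : realType) n (U : set ('rV[R]_n * R))
    (f : 'rV[R]_n * R -> R) p :
  open U -> smooth_on U f -> U p -> strict_derivative f (st_diff f p) p.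
Proof.
move=> oU sf Up e e0.
have Un : \forall x \near p, U x by exact: open_nbhs_nbhs.
have m0 : 0 < (n.+1)%:R :> R by rewrite ltr0n.
have [d d0 dP] : exists2 d : R, 0 < d & forall q (a : option 'I_n -> R),
    `|q - p| < d -> (forall k, `|a k| < d) ->
    `|f (q + \sum_k a k *: st_basis R k) - f q
      - \sum_k a k * 'D_(st_basis R k) f p|
    <= (e / (n.+1)%:R) * \sum_k `|a k|.
  near (0 : R)^'+ => d; exists d => //.
  near: d; apply: strict_estimate_family; last by rewrite divr_gt0.
  - by move=> k; apply: filterS Un => x Ux; exact: smooth_derivable sf Ux.
  - by move=> k; apply: smooth_continuous (smooth_derive _ sf) Up.
near=> r => q q' qr q'r.
(* q and q' are both within r of p, so the coordinates of q - q' are below 2 r. *)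
have r2 : r + r < d.
  have : r < d / 2 by near: r; apply: nbhs_right_lt; rewrite divr_gt0.
  by lra.
have r0 : 0 < r by [].
have qq : `|q - q'| < d.
  rewrite -(subrKA p) (le_lt_trans (ler_normD _ _)) //.
  by rewrite (lt_trans _ r2) // ltrD // distrC.
have := dP q' (st_coord (q - q')) (lt_trans q'r _)
   (fun k => le_lt_trans (ler_st_coord _ _) qq).
rewrite -st_decomp [q' + _]addrC subrK => /(_ _)/le_trans; apply; first by lra.
rewrite mulrAC -mulrA ler_pM2l // ler_pdivrMr // mulrC.
apply: (@le_trans _ _ (\sum_(k : option 'I_n) `|q - q'|)).
  by apply: ler_sum => k _; exact: ler_st_coord.
by rewrite sumr_const card_option card_ord mulr_natl.
Unshelve. all: by end_near. Qed.

Lemma near_eq_continuous (R : realType) (V W : normedModType R) (f g : V -> W) x :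
  (\forall y \near x, f y = g y) -> {for x, continuous f} -> {for x, continuous g}.
Proof.
move=> fg cf; rewrite /prop_for /continuous_at -(nbhs_singleton fg).
by apply: cvg_trans cf; apply: near_eq_cvg; exact: fg.
Qed.

Lemma iter_derive_coord (R : realType) (V : normedModType R) m n (U : set V)
    (F : V -> 'M[R]_(m, n)) i j vs x : open U -> smooth_on U F -> U x ->
  iter_derive vs (fun y => F y i j) x = iter_derive vs F x i j.
Proof.
move=> oU sF; elim: vs x => [|v vs IH] x Ux //=.
rewrite (@near_eq_derive _ _ _ _ (fun y => iter_derive vs F y i j)); last first.
  have Un : \forall y \near x, U y by exact: open_nbhs_nbhs.
  by apply: filterS Un => y /IH.
have [_ /(_ v) dF] := sF vs x Ux.
by rewrite (derive_mx dF) mxE.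
Qed.

Lemma smooth_coord (R : realType) (V : normedModType R) m n (U : set V)
    (F : V -> 'M[R]_(m, n)) i j : open U -> smooth_on U F ->
  smooth_on U (fun y => F y i j).
Proof.
move=> oU sF vs x Ux; have [cF dF] := sF vs x Ux.
have E : \forall y \near x,
    iter_derive vs F y i j = iter_derive vs (fun y => F y i j) y.
  have Un : \forall y \near x, U y by exact: open_nbhs_nbhs.
  by apply: filterS Un => y Uy; rewrite (iter_derive_coord _ _ _ oU sF).
split.
  apply: (near_eq_continuous E).
  apply: (@continuous_comp _ _ _ _ (fun N : 'M[R]_(m, n) => N i j) x cF).
  exact: coord_continuous.
move=> v; apply: (near_eq_derivable E).
by have /derivable_mxP := dF v; exact.
Qed.

Lemma smooth_strict (R : realType) n m1 m2 (U : set ('rV[R]_n * R))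
    (f : 'rV[R]_n * R -> 'M[R]_(m1, m2)) p :
  open U -> smooth_on U f -> U p -> strict_derivative f (st_diff f p) p.
Proof.
move=> oU sf Up; apply: strict_derivative_mx => i j.
have sfij := smooth_coord i j oU sf.
have -> : (fun q => st_diff f p q i j) = st_diff (fun q => f q i j) p.
  apply/funext => q; rewrite /st_diff summxE; apply: eq_bigr => k _.
  by rewrite mxE (derive_mx (smooth_derivable sf Up)) mxE.
exact: smooth_strict_scalar sfij Up.
Qed.

Lemma smooth_differentiable_scalar (R : realType) n (U : set ('rV[R]_n * R))
    (f : 'rV[R]_n * R -> R) p :
  open U -> smooth_on U f -> U p -> differentiable f p.
Proof.
move=> oU sf Up.
by case: (strict_is_diff (@st_diff_continuous _ _ _ f p)
  (smooth_strict_scalar oU sf Up)).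
Qed.

Lemma smooth_differentiable (R : realType) n m1 m2 (U : set ('rV[R]_n * R))
    (f : 'rV[R]_n * R -> 'M[R]_(m1, m2)) p :
  open U -> smooth_on U f -> U p -> differentiable f p.
Proof.
move=> oU sf Up.
by case: (strict_is_diff (@st_diff_continuous _ _ _ f p)
  (smooth_strict oU sf Up)).
Qed.

(** * Symmetry of second derivatives *)

Lemma is_derive_translate (R : realType) (V W : normedModType R) (f : V -> W)
    (x y v : V) :
  derivable f (x + y) v -> is_derive x v (fun z => f (z + y)) ('D_v f (x + y)).
Proof.
move=> df.
have E : (fun h : R => h^-1 *: (f (h *: v + x + y) - f (x + y)))
       = (fun h : R => h^-1 *: (f (h *: v + (x + y)) - f (x + y))).
  by apply/funext => h; rewrite addrA.
by apply: DeriveDef; rewrite /derivable /derive /= E.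
Qed.

(** Two applications of the mean value theorem: first in the direction v, to the
    difference of f and its translate by a *: w, then in the direction w, to 'D_v f. *)
Lemma second_difference (R : realType) (V : normedModType R) (f : V -> R)
    (p v w : V) (a : R) :
  (forall c c', `|c| <= `|a| -> `|c'| <= `|a| ->
    derivable f (p + c *: v + c' *: w) v /\
    derivable ('D_v f) (p + c *: v + c' *: w) w) ->
  exists c c', [/\ `|c| <= `|a|, `|c'| <= `|a| &
    f (p + a *: v + a *: w) - f (p + a *: v) - (f (p + a *: w) - f p) =
    a * (a * 'D_w ('D_v f) (p + c *: v + c' *: w))].
Proof.
move=> df.
have d0 c : `|c| <= `|a| -> derivable f (p + c *: v) v.
  move=> ca; have := df c 0 ca; rewrite normr0 scale0r addr0.
  by case/(_ (normr_ge0 a)) => h _; exact: h.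
have da c : `|c| <= `|a| -> derivable f (p + c *: v + a *: w) v.
  by move=> ca; exact: (df c a ca (lexx _)).1.
pose g x := f (x + a *: w) - f x.
have dg c : `|c| <= `|a| -> is_derive (p + c *: v) v g
    ('D_v f (p + c *: v + a *: w) - 'D_v f (p + c *: v)).
  move=> ca; apply: is_deriveB; first exact: is_derive_translate (da c ca).
  exact: derivableP (d0 c ca).
have [c ca Ec] := mvt_line (fun c ca => @ex_derive _ _ _ _ _ _ _ (dg c ca)).
have [c' ca' Ec'] := mvt_line (fun c' ca' => (df c c' ca ca').2).
exists c, c'; split => //.
rewrite -Ec'; rewrite -(@derive_val _ _ _ _ _ _ _ (dg c ca)) -Ec /g.
by rewrite addrAC.
Qed.

Lemma ball_dist2 (R : realType) (V : normedModType R) (U : set V)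
    (g g' : V -> R) (p : V) (e : R) :
  open U -> U p -> {for p, continuous g} -> {for p, continuous g'} -> 0 < e ->
  exists2 d : R, 0 < d & forall x, ball p d x ->
    [/\ U x, `|g p - g x| <= e & `|g' p - g' x| <= e].
Proof.
move=> oU Up /cvgrPdist_le cg /cvgrPdist_le cg' e0.
have Un : \forall x \near p, U x by exact: open_nbhs_nbhs.
have /nbhs_ballP[d /= d0 dP] : \forall x \near p,
    [/\ U x, `|g p - g x| <= e & `|g' p - g' x| <= e].
  by near=> x; split; near: x => //; [exact: cg|exact: cg'].
by exists d.
Unshelve. all: by end_near. Qed.

Lemma dist_le_via (R : realType) (x y z e : R) :
  `|x - z| <= e -> `|y - z| <= e -> `|x - y| <= e + e.
Proof.
move=> xz yz; rewrite -(subrKA z) (le_trans (ler_normD _ _)) // lerD //.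
by rewrite distrC.
Qed.

(** The second difference is symmetric in v and w, so it equals a ^ 2 times a value
    of either mixed derivative near p; continuity then forces the two to agree at p. *)
Lemma derive_commute (R : realType) (V : normedModType R) (U : set V)
    (f : V -> R) (p v w : V) :
  open U -> smooth_on U f -> U p -> 'D_v ('D_w f) p = 'D_w ('D_v f) p.
Proof.
move=> oU sf Up; apply/subr0_eq/normr0_eq0/eqP; apply: contraT => N0.
set A := 'D_v ('D_w f) p in N0 *; set B := 'D_w ('D_v f) p in N0 *.
(* Both mixed derivatives are within e of a common value, and 2 e < |A - B|. *)
pose e := `|A - B| / 4.
have e0 : 0 < e by rewrite divr_gt0 // lt_def N0 normr_ge0.
have cc v' w' := smooth_continuous (smooth_derive v' (smooth_derive w' sf)) Up.
have [d d0 dP] := ball_dist2 oU Up (cc v w) (cc w v) e0.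
(* The parallelogram spanned by a *: v and a *: w at p stays within d of p. *)
pose a := d / (`|v| + `|w| + 1) / 2.
have s0 : 0 < `|v| + `|w| + 1 by rewrite ltr_wpDl // addr_ge0.
have a0 : 0 < a by rewrite /a !divr_gt0.
have inb v' w' c c' : `|v'| + `|w'| = `|v| + `|w| -> `|c| <= `|a| ->
    `|c'| <= `|a| -> ball p d (p + c *: v' + c' *: w').
  rewrite (gtr0_norm a0) -ball_normE /= => vw ca ca'.
  rewrite -addrA opprD addrA subrr sub0r normrN.
  apply: (le_lt_trans (ler_normD _ _)).
  rewrite !normrZ; apply: (@le_lt_trans _ _ (a * (`|v| + `|w|))).
    by rewrite -vw mulrDr lerD // ler_wpM2r.
  apply: (@le_lt_trans _ _ (d / 2)); last by lra.
  rewrite /a mulrAC ler_pM2r ?invr_gt0 // -mulrA ler_piMr ?(ltW d0) //.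
  by rewrite mulrC ler_pdivrMr // mul1r lerDl.
have dd v' w' c c' : `|v'| + `|w'| = `|v| + `|w| -> `|c| <= `|a| ->
    `|c'| <= `|a| -> derivable f (p + c *: v' + c' *: w') v' /\
    derivable ('D_v' f) (p + c *: v' + c' *: w') w'.
  move=> vw ca ca'; have [Ux _ _] := dP _ (inb _ _ _ _ vw ca ca').
  split; first exact: smooth_derivable sf Ux.
  exact: smooth_derivable (smooth_derive _ sf) Ux.
have [c1 [c1' [h1 h1' E1]]] := second_difference (fun c c' => dd v w c c' erefl).
have wv : `|w| + `|v| = `|v| + `|w| by rewrite addrC.
have [c2 [c2' [h2 h2' E2]]] := second_difference (fun c c' => dd w v c c' wv).
have swap (m1 m2 m3 m4 : R) : m1 - m2 - (m3 - m4) = m1 - m3 - (m2 - m4) by ring.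
have E : 'D_w ('D_v f) (p + c1 *: v + c1' *: w)
       = 'D_v ('D_w f) (p + c2 *: w + c2' *: v).
  apply: (mulfI (lt0r_neq0 a0)); apply: (mulfI (lt0r_neq0 a0)).
  apply: etrans (esym E1) (etrans _ E2).
  by rewrite [p + a *: w + a *: v]addrAC; exact: swap.
have [_ _ B1] := dP _ (inb _ _ _ _ erefl h1 h1').
have [_ A1 _] := dP _ (inb _ _ _ _ wv h2 h2').
rewrite E in B1; have AB : `|A - B| <= e + e := dist_le_via A1 B1.
have AB0 : 0 < `|A - B| by rewrite lt_def N0 normr_ge0.
by move: AB AB0; rewrite /e; move: `|A - B| => m; clear; lra.
Qed.

(** * Local inversion in space, uniformly in time *)

(* Declared so that the Banach fixed point theorem applies to row vectors. *)
HB.instance Definition _ (R : realType) m n := NormedModule.on 'M[R]_(m, n).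

(** The bound on the displacement of the centre makes T preserve the closed ball. *)
Lemma ball_fixed_point (R : realType) (X : completeNormedModType R)
    (T : X -> X) (x0 : X) (rho : R) :
  0 <= rho ->
  (forall x y, `|x - x0| <= rho -> `|y - x0| <= rho ->
    `|T x - T y| <= 2^-1 * `|x - y|) ->
  `|T x0 - x0| <= rho / 2 ->
  exists2 x, `|x - x0| <= rho & T x = x.
Proof.
move=> rho0 Tc T0.
pose U := closed_ball_ (@Num.Def.normr _ X) x0 rho.
have UE x : U x = (`|x - x0| <= rho) :> Prop by rewrite /U /closed_ball_ /= distrC.
have TU : {homo T : x / U x >-> U x}.
  move=> x; rewrite !UE => xU; rewrite -(subrKA (T x0)).
  apply: (le_trans (ler_normD _ _)).
  have := Tc x x0 xU; rewrite subrr normr0 => /(_ rho0) h.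
  by move: xU h T0; lra.
have Tctr : is_contraction (mkfun_fun TU).
  exists (2^-1)%:nng; split; first by rewrite /= invf_lt1 // ltr1n.
  by move=> [x y] /= [Ux Uy]; apply: Tc; rewrite -UE.
have [] := banach_fixed_point Tctr.
- exact: closed_closed_ball_.
- by exists x0; rewrite UE subrr normr0.
- by move=> x Ux Ex; exists x; rewrite -?UE.
Qed.

Lemma mulmx_bounded (R : realType) n (B : 'M[R]_n) :
  exists2 k : R, 0 < k & forall v : 'rV[R]_n, `|v *m B| <= k * `|v|.
Proof.
exists (1 + \sum_i \sum_j `|B i j|).
  by rewrite ltr_pwDl // sumr_ge0 // => i _; rewrite sumr_ge0.
move=> v; apply: ler_mx_norm.
  by rewrite mulr_ge0 // addr_ge0 // sumr_ge0 // => i _; rewrite sumr_ge0.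
move=> i j; rewrite mxE; apply: (le_trans (ler_norm_sum _ _ _)).
rewrite mulrDl mul1r mulr_suml ler_wpDl //; apply: ler_sum => k _.
rewrite normrM mulrC ler_pM // ?ler_coord_norm //.
by rewrite (bigD1 j) //= lerDl sumr_ge0.
Qed.

Section LocalInverse.
Context {R : realType} {n : nat}.
Variables (F : 'rV[R]_n * R -> 'rV[R]_n) (L : {linear ('rV[R]_n * R)%type -> 'rV[R]_n}).
Variables (z0 : 'rV[R]_n) (t0 : R) (A : 'M[R]_n).
Hypothesis sF : strict_derivative F L (z0, t0).
Hypothesis LA : forall v, L (v, 0) = v *m A.
Hypothesis Au : A \in unitmx.

Lemma prod_dist_lt (z w : 'rV[R]_n) (s t r : R) :
  `|(z, s) - (w, t)| < r = (`|z - w| < r) && (`|s - t| < r).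
Proof. by rewrite prod_normE /= gt_max. Qed.

(** After composition with the inverse of A, the map z |-> F (z, s) differs from the
    identity by a function with Lipschitz constant 1/2, uniformly in s. *)
Lemma near_identity : \forall r \near 0^'+, forall z w s,
  `|z - z0| < r -> `|w - z0| < r -> `|s - t0| < r ->
  `|(z - w) - (F (z, s) - F (w, s)) *m invmx A| <= 2^-1 * `|z - w|.
Proof.
have [k k0 kP] := mulmx_bounded (invmx A).
(* The inverse of A multiplies the error by at most k, which leaves 1/2. *)
have e0 : 0 < (2 * k)^-1 by rewrite invr_gt0 mulr_gt0.
have := sF e0; apply: filterS => r rP z w s zr wr sr.
have := rP (z, s) (w, s); rewrite !prod_dist_lt zr wr sr.
move=> /(_ isT isT).
have -> : (z, s) - (w, s) = (z - w, 0) by congr pair; rewrite /= subrr.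
rewrite LA => h.
rewrite -{1}[z - w](mulmxK Au) -mulmxBl.
rewrite (le_trans (kP _)) // distrC.
rewrite prod_normE /= normr0 max_l // in h.
rewrite -ler_pdivlMl // (le_trans h) // invfM mulrA.
by rewrite [k^-1 * _]mulrC.
Qed.

Lemma local_injectivity : \forall r \near 0^'+, forall z w s,
  `|z - z0| < r -> `|w - z0| < r -> `|s - t0| < r ->
  F (z, s) = F (w, s) -> z = w.
Proof.
apply: filterS near_identity => r rP z w s zr wr sr E.
have := rP z w s zr wr sr; rewrite E subrr mul0mx subr0 => h.
apply/subr0_eq/normr0_eq0/eqP; rewrite eq_le normr_ge0 andbT; lra.
Qed.

Hypothesis cL : continuous L.

(** The linear bound on the displacement of the preimage is what allows derivatives
    to be transported by F. *)
Lemma local_section : exists2 C : R, 0 < C &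
  \forall q \near (F (z0, t0), t0), exists2 z,
    F (z, q.2) = q.1 & `|z - z0| <= C * `|q - (F (z0, t0), t0)|.
Proof.
have [k k0 kP] := mulmx_bounded (invmx A).
have [l l0 lP] := linear_lipschitz cL.
(* T below moves z0 by at most k * (2 + l) * D for D the distance of q to the
   centre: 1 for the change of y, 1 + l for the change of F in time; the factor 2
   accounts for the contraction constant 1/2. *)
pose C := 2 * (k * (2 + l)).
have C0 : 0 < C by rewrite !mulr_gt0 // addr_gt0.
exists C => //.
have [r r0 [rP rF]] : exists2 r : R, 0 < r & (forall z w s,
    `|z - z0| < r -> `|w - z0| < r -> `|s - t0| < r ->
    `|(z - w) - (F (z, s) - F (w, s)) *m invmx A| <= 2^-1 * `|z - w|) /\
    (forall q q', `|q - (z0, t0)| < r -> `|q' - (z0, t0)| < r ->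
    `|F q - F q' - L (q - q')| <= 1 * `|q - q'|).
  near (0 : R)^'+ => r; exists r => //.
  by split; near: r; [exact: near_identity|exact: sF].
pose d := Num.min r (r / C).
have d0 : 0 < d by rewrite lt_min r0 divr_gt0.
apply/nbhs_ballP; exists d => //= -[y s]; rewrite -ball_normE /= distrC.
rewrite lt_min => /andP[]; set D := `|_ - _| => Dr; rewrite ltr_pdivlMr // mulrC => DC.
have sD : `|s - t0| <= D by rewrite /D prod_normE le_max lexx orbT.
have yD : `|y - F (z0, t0)| <= D by rewrite /D prod_normE le_max lexx.
have sr := le_lt_trans sD Dr.
(* A fixed point of T is a solution of F (z, s) = y. *)
pose T z := z + (y - F (z, s)) *m invmx A.
have D0 : 0 <= C * D := mulr_ge0 (ltW C0) (normr_ge0 _).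
have [z zD Tz] : exists2 z, `|z - z0| <= C * D & T z = z.
  apply: ball_fixed_point => //.
    move=> z w zD wD.
    have := rP z w s (le_lt_trans zD DC) (le_lt_trans wD DC) sr.
    congr (`|_| <= _); rewrite /T opprD addrACA -mulmxBl; congr (_ + _).
    by rewrite -mulNmx !opprB [y - _ + _]addrC subrKA.
  rewrite /T addrC addKr (le_trans (kP _)) //.
  have -> : C * D / 2 = k * ((2 + l) * D) by rewrite /C; field.
  rewrite ler_pM2l //.
  have h : `|F (z0, s) - F (z0, t0)| <= (1 + l) * D.
    have := rF (z0, s) (z0, t0); rewrite !prod_dist_lt !subrr !normr0 r0 sr.
    have -> : (z0, s) - (z0, t0) = (0, s - t0) by congr pair; rewrite /= subrr.
    move=> /(_ isT isT).
    set X := F _ - F _ => XL.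
    rewrite -(subrK (L (0, s - t0)) X) (le_trans (ler_normD _ _)) //.
    have N0 : `|((0, s - t0) : 'rV[R]_n * R)| <= D.
      by rewrite prod_normE /= normr0 max_r.
    rewrite mulrDl lerD ?mul1r //; first by rewrite (le_trans XL) // mul1r.
    by rewrite (le_trans (lP _)) // ler_pM2l.
  rewrite -(subrKA (F (z0, t0))) (le_trans (ler_normD _ _)) //.
  by rewrite [X in _ + X]distrC; lra.
exists z => //; apply/eqP; rewrite -subr_eq0 -oppr_eq0 opprB.
have /eqP : (y - F (z, s)) *m invmx A = 0.
  by apply: (addrI z); rewrite addr0.
move=> /eqP /(congr1 (mulmx^~ A)); rewrite mulmxKV // mul0mx => ->.
by rewrite eqxx.
Unshelve. all: by end_near. Qed.

End LocalInverse.

(** * Differentiability of Eulerian fields *)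

(** If g (Phi p) = G p, and each q near Phi p0 has a preimage p with
    |p - p0| <= C |q - Phi p0|, then g inherits the derivative dG o B, where B is a
    left inverse of dPhi: errors that are small with respect to p - p0 are small
    with respect to q - Phi p0. *)
Lemma differentiable_of_section (R : realType) (V V' W : normedModType R)
    (Phi : V -> V') (dPhi : {linear V -> V'}) (B : {linear V' -> V})
    (G : V -> W) (g : V' -> W) (p0 : V) (C : R) :
  is_diff p0 Phi dPhi -> continuous dPhi -> continuous B ->
  (forall v, B (dPhi v) = v) -> differentiable G p0 -> 0 < C ->
  (\forall q \near Phi p0, exists2 p, Phi p = q /\ g q = G p &
     `|p - p0| <= C * `|q - Phi p0|) ->
  differentiable g (Phi p0).
Proof.
move=> dP cdP cB BK dG C0 sec.
have cdG : continuous ('d G p0) by exact: diff_continuous.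
have gq0 : g (Phi p0) = G p0.
  have [p [_ ->]] := nbhs_singleton sec.
  by rewrite subrr normr0 mulr0 normr_le0 subr_eq0 => /eqP ->.
have cL : continuous ('d G p0 \o B).
  by move=> x; apply: continuous_comp; [exact: cB|exact: cdG].
have [K K0 KP] := linear_lipschitz cL.
suff [] : is_diff (Phi p0) g ('d G p0 \o B) by [].
apply/is_diff_estimate => // e e0.
pose e1 := e / ((1 + K) * C).
have e10 : 0 < e1 by rewrite divr_gt0 // mulr_gt0 // addr_gt0.
have /is_diff_estimate := differentiableP dG; move=> /(_ cdG) /(_ e1 e10) hG.
have /is_diff_estimate := dP; move=> /(_ cdP) /(_ e1 e10) hP.
have /nbhs_ballP[d /= d0 dd] : \forall p \near p0,
    `|G p - G p0 - 'd G p0 (p - p0)| <= e1 * `|p - p0| /\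
    `|Phi p - Phi p0 - dPhi (p - p0)| <= e1 * `|p - p0|.
  exact: filterI hG hP.
have /nbhs_ballP[r /= r0 rr] := sec.
apply/nbhs_ballP; exists (Num.min r (d / C)) => /=.
  by rewrite lt_min r0 divr_gt0.
move=> q; rewrite -ball_normE /= lt_min => /andP[qr].
rewrite ltr_pdivlMr // mulrC distrC => qd.
have [|p [Pq ->] pC] := rr q; first by rewrite -ball_normE.
have [|hGp hPp] := dd p; first by rewrite -ball_normE /= distrC (le_lt_trans pC).
rewrite /= gq0 -Pq; set h := p - p0 in hGp hPp pC *.
set r2 := Phi p - Phi p0 - dPhi h in hPp.
have -> : Phi p - Phi p0 = dPhi h + r2 by rewrite [RHS]addrC subrK.
rewrite (linearD B) BK linearD opprD addrA (le_trans (ler_normB _ _)) //.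
apply: (@le_trans _ _ (e1 * `|h| + K * (e1 * `|h|))).
  by rewrite lerD // (le_trans (KP _)) // ler_wpM2l // ltW.
have -> : e1 * `|h| + K * (e1 * `|h|) = e / C * `|h|.
  by rewrite /e1; field; rewrite !gt_eqF //= addr_gt0.
rewrite mulrAC ler_pdivrMr // -mulrA ler_pM2l // mulrC.
by rewrite [dPhi h + _]addrC subrK Pq.
Qed.

Section Eulerian.
Context {R : realType} {n : nat}.
Variables (F : 'rV[R]_n * R -> 'rV[R]_n) (L : {linear ('rV[R]_n * R)%type -> 'rV[R]_n}).
Variables (z0 : 'rV[R]_n) (t0 : R) (A : 'M[R]_n).
Hypothesis sF : strict_derivative F L (z0, t0).
Hypothesis LA : forall v, L (v, 0) = v *m A.
Hypothesis Au : A \in unitmx.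
Hypothesis cL : continuous L.

Let V : normedModType R := ('rV[R]_n * R)%type.
(* B undoes dPhi: once the displacement L (0, q.2) due to time is subtracted, what
   is left is spatial and A inverts it. *)
Let Phi : V -> V := fun p => (F p, p.2).
Let dPhi : V -> V := fun v => (L v, v.2).
Let B : V -> V := fun q => ((q.1 - L (0, q.2)) *m invmx A, q.2).

Let dPhi_linear : linear dPhi.
Proof. by move=> a u v; rewrite /dPhi linearP. Qed.
HB.instance Definition _ := GRing.isLinear.Build R V V _ dPhi dPhi_linear.

Let B_linear : linear B.
Proof.
move=> a u v; congr pair => /=.
have -> : ((0 : 'rV[R]_n), a *: u.2 + v.2) = a *: (0, u.2) + (0, v.2).
  by congr pair; rewrite /= scaler0 addr0.
by rewrite linearP opprD addrACA -scalerBr mulmxDl scalemxAl.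
Qed.
HB.instance Definition _ := GRing.isLinear.Build R V V _ B B_linear.

Let dPhi_continuous : continuous dPhi.
Proof.
have [l l0 lP] := linear_lipschitz cL.
apply: (@bounded_linear_cts _ _ _ dPhi (l + 1)) => v.
rewrite {1}prod_normE ge_max mulrDl mul1r; apply/andP; split.
  by rewrite (le_trans (lP _)) // lerDl.
rewrite ler_wpDl //; first by rewrite mulr_ge0 // ltW.
by rewrite [leRHS]prod_normE le_max lexx orbT.
Qed.

Let B_continuous : continuous B.
Proof.
have [k k0 kP] := mulmx_bounded (invmx A).
have [l l0 lP] := linear_lipschitz cL.
apply: (@bounded_linear_cts _ _ _ B (k * (1 + l) + 1)) => -[y s].
set N := `|(y, s)|.
have yN : `|y| <= N by rewrite /N prod_normE le_max lexx.
have sN : `|s| <= N by rewrite /N prod_normE le_max lexx orbT.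
rewrite prod_normE /= ge_max; apply/andP; split; last first.
  by rewrite (le_trans sN) // ler_peMl ?normr_ge0 // lerDr mulr_ge0 ?addr_ge0 // ltW.
rewrite (le_trans (kP _)) // mulrDl mul1r -mulrA.
apply: (@le_trans _ _ (k * ((1 + l) * N))); last by rewrite lerDl normr_ge0.
rewrite ler_pM2l // (le_trans (ler_normB _ _)) // mulrDl mul1r lerD //.
rewrite (le_trans (lP _)) // ler_pM2l // prod_normE /= normr0 max_r //.
Qed.

(** A field g is given only through its values G along trajectories; here it is shown
    differentiable first, and then the chain rule applies to G = g o Phi. *)
Lemma eulerian_chain (W : normedModType R) (G g : V -> W) :
  differentiable G (z0, t0) ->
  (\forall p \near (z0, t0), g (F p, p.2) = G p) ->
  forall v, 'D_v G (z0, t0) =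
    \sum_k (L v) 0 k *: 'D_(basis_vec R k, 0) g (F (z0, t0), t0)
    + v.2 *: 'D_(0, 1) g (F (z0, t0), t0).
Proof.
move=> dG gG.
have dF : is_diff (z0, t0) F L := strict_is_diff cL sF.
have dP : is_diff ((z0, t0) : V) Phi dPhi.
  apply/(is_diff_estimate _ _ dPhi_continuous) => e e0.
  have /(is_diff_estimate _ _ cL) /(_ e e0) := dF.
  apply: filterS => q h; rewrite {1}prod_normE /= subrr normr0 max_l //.
have BK v : B (dPhi v) = v.
  case: v => v s; congr pair => /=; rewrite -linearB /=.
  have -> : (v, s) - (0, s) = (v, 0) by congr pair; rewrite /= ?subr0 ?subrr.
  by rewrite LA mulmxK.
have dg : differentiable g (F (z0, t0), t0).
  have [C C0 sur] := local_section sF LA Au cL.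
  apply: (@differentiable_of_section R V V W Phi dPhi B G g (z0, t0) (C + 1)) => //.
    by rewrite addr_gt0.
  have /nbhs_ballP[d /= d0 dd] := gG.
  have /nbhs_ballP[r /= r0 rr] := sur.
  apply/nbhs_ballP; exists (Num.min r (d / (C + 1))) => /=.
    by rewrite lt_min r0 divr_gt0 // addr_gt0.
  move=> q; rewrite -ball_normE /= lt_min => /andP[qr].
  rewrite ltr_pdivlMr ?addr_gt0 // mulrC distrC => qd.
  have [|z Fz zC] := rr q; first by rewrite -ball_normE.
  have pC : `|(z, q.2) - (z0, t0)| <= (C + 1) * `|q - Phi (z0, t0)|.
    rewrite prod_normE /= ge_max mulrDl mul1r; apply/andP; split.
      by rewrite (le_trans zC) // lerDl.
    rewrite ler_wpDl //; first by rewrite mulr_ge0 // ltW.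
    by rewrite [leRHS]prod_normE le_max lexx orbT.
  exists (z, q.2) => //; split; first by rewrite /Phi Fz; case: (q).
  rewrite -dd; first by rewrite Fz; case: (q).
  by rewrite -ball_normE /= distrC (le_lt_trans pC).
move=> v.
have -> : 'D_v G (z0, t0) = 'D_v (g \o Phi) (z0, t0).
  by apply: near_eq_derive; apply: filterS gG => p /= ->.
have [dPh dPhE] := dP.
rewrite deriveE; last exact: differentiable_comp.
rewrite diff_comp // dPhE /=.
rewrite [dPhi v]st_decomp linear_sum sum_option addrC; congr (_ + _).
  by apply: eq_bigr => k _; rewrite linearZ -deriveE.
by rewrite linearZ -deriveE.
Qed.

End Eulerian.

(** * Partial derivatives on space-time and Jacobi's formula *)

(** Uncurrying, in the form used by smooth_on_spacetime. *)
Definition st (R : realType) n (W : normedModType R)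
    (f : 'rV[R]_n -> R -> W) : 'rV[R]_n * R -> W := fun p => f p.1 p.2.

(** The difference quotients agree term by term: a step along (e_i, 0) fixes t. *)
Lemma partialE (R : realType) n (W : normedModType R)
    (f : 'rV[R]_n -> R -> W) i z t :
  partial i (f^~ t) z = 'D_(basis_vec R i, 0) (st f) (z, t).
Proof.
rewrite /partial /derive; set g := fun h : R => _; set g' := fun h : R => _.
suff -> : g = g' by [].
apply/funext => h; rewrite /g /g'.
by rewrite /st /= scaler0 add0r.
Qed.

Lemma dtE (R : realType) n (W : normedModType R)
    (f : 'rV[R]_n -> R -> W) z t :
  dt f z t = 'D_(0, 1) (st f) (z, t).
Proof.
rewrite /dt /derive1 /derive; set g := fun h : R => _; set g' := fun h : R => _.
suff -> : g = g' by [].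
apply/funext => h; rewrite /g /g'.
by rewrite /st /= scaler0 add0r [_%:A]mulr1.
Qed.

Lemma st_partial (R : realType) n (W : normedModType R)
    (f : 'rV[R]_n -> R -> W) i :
  st (fun z t => partial i (f^~ t) z) = 'D_(basis_vec R i, 0) (st f).
Proof. by apply/funext => -[z t]; rewrite /st /= partialE. Qed.

Lemma st_dt (R : realType) n (W : normedModType R) (f : 'rV[R]_n -> R -> W) :
  st (dt f) = 'D_(0, 1) (st f).
Proof. by apply/funext => -[z t]; rewrite {1}/st /= dtE. Qed.

Lemma derivable_time (R : realType) n (W : normedModType R)
    (f : 'rV[R]_n -> R -> W) z t :
  derivable (st f) (z, t) (0, 1) -> derivable (f z) t 1.
Proof.
rewrite /derivable; set g := fun h : R => _; set g' := fun h : R => _.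
suff -> : g = g' by [].
apply/funext => h; rewrite /g /g'.
by rewrite /st /= scaler0 add0r.
Qed.

Lemma derivable_space (R : realType) n (W : normedModType R)
    (f : 'rV[R]_n -> R -> W) i z t :
  derivable (st f) (z, t) (basis_vec R i, 0) ->
  derivable (f^~ t) z (basis_vec R i).
Proof.
rewrite /derivable; set g := fun h : R => _; set g' := fun h : R => _.
suff -> : g = g' by [].
apply/funext => h; rewrite /g /g'.
by rewrite /st /= scaler0 add0r.
Qed.

Lemma time_independentP (R : realType) n (D : set 'rV[R]_n) (I : set R)
    (f : 'rV[R]_n -> R -> R) :
  open_interval I -> (forall z t, D z -> I t -> derivable (f z) t 1) ->
  time_independent D I f <-> (forall z t, D z -> I t -> dt f z t = 0).
Proof.
move=> [_ oI iI] df; split=> [fc z t Dz It|f0 z Dz].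
  rewrite /dt derive1E -(@derive_cst R R R (f z t) t 1).
  apply: near_eq_derive.
  have In : \forall s \near t, I s by exact: open_nbhs_nbhs.
  by apply: filterS In => s Is; exact: fc.
have mono s t : I s -> I t -> s <= t -> f z s = f z t.
  move=> Is It st.
  have sI x : x \in `[s, t] -> I x.
    by rewrite in_itv /= => /andP[sx xt]; apply: (iI s t) => //; apply/andP.
  have [||c _ E] := @MVT_segment R (f z) (fun=> 0) s t st.
  - move=> x /subset_itv_oo_cc /sI Ix; apply: DeriveDef; first exact: df.
    by rewrite -derive1E; exact: f0.
  - by apply: derivable_within_continuous => x /sI Ix; exact: df.
  - by apply/esym/eqP; rewrite -subr_eq0 E mul0r.
by move=> s t Is It; case: (leP s t) => [|/ltW] h; [|apply/esym]; exact: mono.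
Qed.

Lemma is_derive_prod (R : realType) (V : normedModType R) (T : eqType)
    (r : seq T) (f : T -> V -> R) (df : T -> R) (x v : V) :
  uniq r -> (forall k, is_derive x v (f k) (df k)) ->
  is_derive x v (fun y => \prod_(k <- r) f k y)
    (\sum_(k <- r) df k * \prod_(i <- r | i != k) f i x).
Proof.
move=> + dfk; elim: r => [_|a r IH /= /andP[ar ur]].
  have -> : (fun y => \prod_(k <- [::]) f k y) = cst 1.
    by apply/funext => y; rewrite big_nil.
  by rewrite big_nil; exact: is_derive_cst.
have -> : (fun y => \prod_(k <- a :: r) f k y)
        = (f a * (fun y => \prod_(k <- r) f k y)).
  by apply/funext => y; rewrite big_cons.
apply: is_derive_eq (is_deriveM (dfk a) (IH ur)) _.
rewrite big_cons /= addrC; congr (_ + _).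
  rewrite big_cons eqxx /= [LHS]mulrC; congr (_ * _).
  rewrite big_seq [RHS]big_seq_cond; apply: eq_bigl => i.
  by case: (boolP (i \in r)) => // ir; apply/esym; apply: contraNneq ar => <-.
rewrite [LHS]mulr_sumr [LHS]big_seq [RHS]big_seq; apply: eq_bigr => k kr.
rewrite big_cons; case: eqVneq => [ak|_] /=; last by rewrite mulrCA.
by rewrite ak kr in ar.
Qed.

(** Jacobi's formula.  By the product rule the derivative of the determinant is the
    sum over k of determinants with row k replaced by its derivative; each of these
    is expanded along row k. *)
Lemma is_derive_det (R : realType) (V : normedModType R) n
    (M : V -> 'M[R]_n) (dM : 'M[R]_n) (x v : V) :
  (forall i j, is_derive x v (fun y => M y i j) (dM i j)) ->
  is_derive x v (fun y => \det (M y)) (\tr (\adj (M x) *m dM)).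
Proof.
move=> dMij.
(* Permutations are enumerated by ordinals to match is_derive_sum. *)
have -> : (fun y => \det (M y)) =
    (fun y => \sum_(k < #|{: 'S_n}|) (-1) ^+ (enum_val k : 'S_n) *:
        \prod_(i <- index_enum 'I_n) M y i ((enum_val k : 'S_n) i)).
  apply/funext => y; rewrite /determinant (reindex_onto (@enum_val _ {: 'S_n}) enum_rank) /=.
    by apply: eq_bigl => k; rewrite enum_valK eqxx.
  by move=> s _; rewrite enum_rankK.
have dk (k : 'I_#|{: 'S_n}|) := @is_deriveZ _ _ _ _ ((-1) ^+ (enum_val k : 'S_n)) _ _ _
  (is_derive_prod (index_enum_uniq 'I_n) (fun i => dMij i ((enum_val k : 'S_n) i))).
have := is_derive_sum dk.
have -> : \sum_(i < #|{: 'S_n}|) (fun y => (-1) ^+ (enum_val i : 'S_n) *: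
   \prod_(j <- index_enum 'I_n) M y j ((enum_val i : 'S_n) j)) = (fun y => \sum_(k < #|{: 'S_n}|) (-1) ^+ (enum_val k : 'S_n) *:
        \prod_(i <- index_enum 'I_n) M y i ((enum_val k : 'S_n) i)).
  by apply/funext => y; rewrite fct_sumE.
move=> h; apply: is_derive_eq h _.
pose N k := \matrix_(i, j) if i == k then dM k j else M x i j.
have NE k : \det (N k) = \sum_j dM k j * \adj (M x) j k.
  rewrite (expand_det_row _ k); apply: eq_bigr => j _.
  rewrite !mxE eqxx; congr (_ * (_ * _)).
  congr (\det _); apply/matrixP => a b; rewrite !mxE.
  by rewrite eq_sym (negbTE (neq_lift _ _)).
rewrite mxtrace_mulC /mxtrace.
under [RHS]eq_bigr => k _ do rewrite mxE -NE.
rewrite /determinant exchange_big /=.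
rewrite [RHS](reindex_onto (@enum_val _ {: 'S_n}) enum_rank) /=; last first.
  by move=> s _; rewrite enum_rankK.
apply: eq_big => [k|k _]; first by rewrite enum_valK eqxx.
rewrite scaler_sumr; apply: eq_bigr => i _.
congr (_ * _); rewrite [RHS](bigD1 i) //= mxE eqxx; congr (_ * _).
by apply: eq_bigr => j ji; rewrite mxE (negbTE ji).
Qed.

(** * Material and Eulerian derivatives *)

Lemma differentiable_slice (R : realType) n (W : normedModType R)
    (f : 'rV[R]_n -> R -> W) z t :
  differentiable (st f) (z, t) -> differentiable (f^~ t) z.
Proof.
move=> df.
have -> : f^~ t = st f \o (fun y => (y, t)) by [].
by apply: differentiable_comp.
Qed.

Lemma open_box (X Y : topologicalType) (A : set X) (B : set Y) :
  open A -> open B -> open (A `*` B).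
Proof.
move=> oA oB; rewrite openE => -[x y] [/= Ax By].
by exists (A, B) => //; split; exact: open_nbhs_nbhs.
Qed.

Section Lagrangian.
Context {R : realType} {n : nat}.
Variables (D : set 'rV[R]_n.+1) (I : set R).
Variables (phi : 'rV[R]_n.+1 -> R -> 'rV[R]_n.+1).
Hypothesis oD : open D.
Hypothesis oI : open I.
Hypothesis sphi : smooth_on_spacetime D I phi.

Local Notation S := (D `*` I).

Lemma open_spacetime : open S.
Proof. exact: open_box. Qed.

Lemma smooth_dt (W : normedModType R) (f : 'rV[R]_n.+1 -> R -> W) :
  smooth_on_spacetime D I f -> smooth_on_spacetime D I (dt f).
Proof.
move=> sf; suff : smooth_on S (st (dt f)) by [].
by rewrite st_dt; exact: smooth_derive.
Qed.

Lemma smooth_partial (W : normedModType R) (f : 'rV[R]_n.+1 -> R -> W) i :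
  smooth_on_spacetime D I f ->
  smooth_on_spacetime D I (fun z t => partial i (f^~ t) z).
Proof.
move=> sf; suff : smooth_on S (st (fun z t => partial i (f^~ t) z)) by [].
by rewrite st_partial; exact: smooth_derive.
Qed.

Lemma smooth_coordinate (F : 'rV[R]_n.+1 -> R -> 'rV[R]_n.+1) j :
  smooth_on_spacetime D I F -> smooth_on_spacetime D I (Defs.coord j F).
Proof. by move=> sF; exact: (smooth_coord 0 j open_spacetime sF). Qed.

Section Scalar.
Variable f : 'rV[R]_n.+1 -> R -> R.
Hypothesis sf : smooth_on_spacetime D I f.

Lemma smooth_derivable_time z t : D z -> I t -> derivable (f z) t 1.
Proof.
by move=> Dz It; apply: derivable_time; apply: (smooth_derivable sf).
Qed.

Lemma smooth_derivable_space i z t : D z -> I t ->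
  derivable (f^~ t) z (basis_vec R i).
Proof.
by move=> Dz It; apply: derivable_space; apply: (smooth_derivable sf).
Qed.

Lemma dt_partial i z t : D z -> I t ->
  dt (fun z t => partial i (f^~ t) z) z t = partial i ((dt f)^~ t) z.
Proof.
move=> Dz It; rewrite dtE partialE st_partial st_dt.
by apply: (derive_commute _ _ open_spacetime sf).
Qed.

Lemma is_derive_partial i z t : D z -> I t ->
  is_derive t 1 (fun s => partial i (f^~ s) z) (partial i ((dt f)^~ t) z).
Proof.
move=> Dz It.
have df : derivable (fun s => partial i (f^~ s) z) t 1.
  apply: (@derivable_time _ _ _ (fun z s => partial i (f^~ s) z)).
  by apply: (smooth_derivable (smooth_partial i sf)).
apply: is_derive_eq (derivableP df) _.
by rewrite -derive1E -(dt_partial i Dz It).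
Qed.

End Scalar.

Lemma dt_coord (F : 'rV[R]_n.+1 -> R -> 'rV[R]_n.+1) j z t :
  smooth_on_spacetime D I F -> D z -> I t ->
  dt F z t 0 j = dt (Defs.coord j F) z t.
Proof.
move=> sF Dz It; rewrite !dtE derive_mx ?mxE //.
exact: (smooth_derivable sF).
Qed.

(** The Jacobian matrix of jacobianE, written with partial derivatives so that its
    entries inherit smoothness in time from phi. *)
Definition dphi z t : 'M[R]_n.+1 :=
  \matrix_(i, j) partial i ((Defs.coord j phi)^~ t) z.

Lemma jacobianE z t : D z -> I t -> 'J (phi^~ t) z = dphi z t.
Proof.
move=> Dz It.
have df : differentiable (phi^~ t) z.
  apply: differentiable_slice.
  exact: (smooth_differentiable open_spacetime sphi).
apply/matrixP => i j; rewrite [RHS]mxE.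
have := deriveEjacobian (basis_vec R i) df.
rewrite /basis_vec -rowE => /(congr1 (fun r : 'rV_n.+1 => r 0 j)).
rewrite [RHS]mxE => <-.
by rewrite derive_mx ?mxE //; exact: diff_derivable.
Qed.

Lemma st_diff_space z t v : D z -> I t ->
  st_diff (st phi) (z, t) (v, 0) = v *m dphi z t.
Proof.
move=> Dz It; apply/rowP => j; rewrite /st_diff sum_option /= scale0r add0r.
rewrite summxE mxE; apply: eq_bigr => k _; rewrite !mxE; congr (_ * _).
rewrite partialE derive_mx ?mxE //.
exact: (smooth_derivable sphi).
Qed.

Lemma st_diff_basis z t i k : D z -> I t ->
  st_diff (st phi) (z, t) (basis_vec R i, 0) 0 k = dphi z t i k.
Proof.
by move=> Dz It; rewrite st_diff_space // /basis_vec -rowE mxE.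
Qed.

Lemma st_diff_time z t : st_diff (st phi) (z, t) (0, 1) = dt phi z t.
Proof.
rewrite /st_diff sum_option /= scale1r dtE big1 ?addr0 // => i _.
by rewrite mxE scale0r.
Qed.

(** Space and time components of the chain rule for G (z, t) = g (phi (z, t), t);
    the last one is the material derivative. *)
Lemma material_derivatives (W : normedModType R)
    (G g : 'rV[R]_n.+1 -> R -> W) (Om : set 'rV[R]_n.+1) (J : set R) z t :
  Om `<=` D -> J `<=` I -> open Om -> open J -> Om z -> J t ->
  dphi z t \in unitmx ->
  differentiable (st G) (z, t) ->
  (forall w s, Om w -> J s -> g (phi w s) s = G w s) ->
  (forall i, partial i (G^~ t) z =
     \sum_k dphi z t i k *: partial k (g^~ t) (phi z t)) /\
  dt G z t = dt g (phi z t) t +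
    \sum_k dt phi z t 0 k *: partial k (g^~ t) (phi z t).
Proof.
move=> OD JI oO oJ Oz Jt ud dG gG.
have Dz := OD z Oz; have It := JI t Jt.
have near_gG : \forall p \near (z, t), st g (st phi p, p.2) = st G p.
  have : \forall p \near (z, t), (Om `*` J) p.
    by apply: open_nbhs_nbhs; split; [exact: open_box|split].
  by apply: filterS => -[w s] [/= Ow Js]; rewrite /st /= gG.
have chain := eulerian_chain
  (smooth_strict open_spacetime sphi (conj Dz It : S (z, t)))
  (fun v => st_diff_space v Dz It) ud (@st_diff_continuous _ _ _ _ _) dG near_gG.
split.
- move=> i; rewrite partialE chain /= scale0r addr0.
  by apply: eq_bigr => k _; rewrite st_diff_basis // partialE.
- rewrite dtE chain /= scale1r addrC -dtE st_diff_time; congr (_ + _).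
  by apply: eq_bigr => k _; rewrite partialE.
Qed.

End Lagrangian.

(** The sums are the entries of M (K - K^T) M^T. *)
Lemma antisymmetric_part_eq0 (R : comUnitRingType) n (M K : 'M[R]_n) :
  M \in unitmx ->
  (forall a b, \sum_j ((M *m K) a j * M b j - (M *m K) b j * M a j) = 0) <->
  (forall a b, K a b = K b a).
Proof.
move=> uM.
have E a b : \sum_j ((M *m K) a j * M b j - (M *m K) b j * M a j)
           = (M *m (K - K^T) *m M^T) a b.
  rewrite mulmxBr mulmxBl -[M *m K^T *m _]mulmxA -trmx_mul.
  rewrite sumrB [RHS]mxE [X in _ = _ + X]mxE; congr (_ - _).
    by rewrite [RHS]mxE; apply: eq_bigr => j _; rewrite [M^T _ _]mxE.
  by rewrite [RHS]mxE; apply: eq_bigr => j _; rewrite [_^T j _]mxE mulrC.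
have TE : (forall a b, K a b = K b a) <-> K - K^T = 0.
  split=> [h|/eqP]; first by apply/matrixP => a b; rewrite !mxE h subrr.
  by rewrite subr_eq0 => /eqP KT a b; rewrite {1}KT mxE.
split=> [h|/TE h a b]; last by rewrite E h mulmx0 mul0mx mxE.
apply/TE.
have : M *m (K - K^T) *m M^T = 0 by apply/matrixP => a b; rewrite -E h mxE.
move=> /(congr1 (fun X => invmx M *m X *m invmx M^T)).
by rewrite mulmx0 mul0mx !mulmxA mulVmx // mul1mx mulmxK ?unitmx_tr.
Qed.

Section Equations.
Context {R : realType} {n : nat}.
Variables (D : set 'rV[R]_n.+1) (I : set R).
Variables (phi : 'rV[R]_n.+1 -> R -> 'rV[R]_n.+1) (rho : 'rV[R]_n.+1 -> R -> R).
Hypothesis oD : open D.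
Hypothesis oI : open I.
Hypothesis sphi : smooth_on_spacetime D I phi.
Hypothesis srho : smooth_on_spacetime D I rho.

Local Notation S := (D `*` I).
Local Notation phi_ j := (Defs.coord j phi).

Let sphi_ j : smooth_on_spacetime D I (phi_ j) :=
  smooth_coordinate oD oI j sphi.

Let differentiable_smooth (f : 'rV[R]_n.+1 -> R -> R) z t :
  smooth_on_spacetime D I f -> D z -> I t -> differentiable (st f) (z, t).
Proof.
move=> sf Dz It.
exact: (smooth_differentiable_scalar (open_spacetime oD oI) sf).
Qed.

Lemma acceleration_coord j z t : D z -> I t ->
  dt (dt phi) z t 0 j = dt (dt (phi_ j)) z t.
Proof.
move=> Dz It; rewrite (dt_coord j (smooth_dt sphi) Dz It).
rewrite {1}/dt [in RHS]/dt !derive1E; apply: near_eq_derive.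
have In : \forall s \near t, I s by exact: open_nbhs_nbhs.
by apply: filterS In => s Is; exact: (dt_coord j sphi Dz Is).
Qed.

(** Material gradient of phi'' + rho e_n, the force felt along trajectories. *)
Definition force_gradient z t : 'M[R]_n.+1 :=
  \matrix_(i, j) (partial i ((dt (dt (phi_ j)))^~ t) z
                  + (j == ord_max)%:R * partial i (rho^~ t) z).

Lemma is_derive_det_dphi z t : D z -> I t ->
  is_derive t 1 (fun s => \det (dphi phi z s))
    (\tr (\adj (dphi phi z t) *m
       \matrix_(i, j) partial i ((dt (phi_ j))^~ t) z)).
Proof.
move=> Dz It; apply: is_derive_det => i j.
have -> : (fun s => dphi phi z s i j) = (fun s => partial i ((phi_ j)^~ s) z).
  by apply/funext => s; rewrite mxE.
by rewrite mxE; exact: (is_derive_partial oD oI (sphi_ j)).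
Qed.

Section Fields.
Variables (Om : set 'rV[R]_n.+1) (J : set R).
Variables (u : 'rV[R]_n.+1 -> R -> 'rV[R]_n.+1) (vrho : 'rV[R]_n.+1 -> R -> R).
Hypotheses (OD : Om `<=` D) (JI : J `<=` I) (oO : open Om) (oJ : open J).
Hypothesis uphi : forall z t, D z -> I t -> dphi phi z t \in unitmx.
Hypothesis fields : determines_fields phi rho Om J u vrho.

Let force y t := dt u y t + convection u y t + vrho y t *: basis_vec R ord_max.

Lemma divergence_det z t : Om z -> J t ->
  dt (fun z t => \det (dphi phi z t)) z t
  = \det (dphi phi z t) * div (u^~ t) (phi z t).
Proof.
move=> Oz Jt; have Dz := OD Oz; have It := JI Jt.
pose U : 'M[R]_n.+1 := \matrix_(k, j) partial k (fun y => u y t 0 j) (phi z t).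
rewrite /dt derive1E (@derive_val _ _ _ _ _ _ _ (is_derive_det_dphi Dz It)).
have -> : \matrix_(i, j) partial i ((dt (phi_ j))^~ t) z = dphi phi z t *m U.
  apply/matrixP => i j; rewrite [LHS]mxE [RHS]mxE.
  have [|w s Ow Js|-> _] := @material_derivatives R n D I phi oD oI sphi _
    (dt (phi_ j)) (fun y s => u y s 0 j) Om J z t OD JI oO oJ Oz Jt (uphi Dz It).
  - exact: differentiable_smooth (smooth_dt (sphi_ j)) Dz It.
  - have [<- _] := fields Ow Js.
    exact: (dt_coord j sphi (OD Ow) (JI Js)).
  - by apply: eq_bigr => k _; rewrite [U k j]mxE.
rewrite mulmxA mul_adj_mx mul_scalar_mx mxtraceZ; congr (_ * _).
by rewrite /mxtrace /div; apply: eq_bigr => i _; rewrite mxE.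
Qed.

Lemma density_transport z t : Om z -> J t ->
  dt rho z t = dt vrho (phi z t) t + dotv (u (phi z t) t) (grad (vrho^~ t) (phi z t)).
Proof.
move=> Oz Jt; have Dz := OD Oz; have It := JI Jt.
have [||_ ->] := @material_derivatives R n D I phi oD oI sphi _
    rho vrho Om J z t OD JI oO oJ Oz Jt (uphi Dz It).
- exact: differentiable_smooth srho Dz It.
- by move=> w s Ow Js; have [] := fields Ow Js.
- congr (_ + _); apply: eq_bigr => k _.
  by have [<- _] := fields Oz Jt; rewrite mxE.
Qed.

(** The material derivative of u is phi''. *)
Lemma acceleration z t : Om z -> J t ->
  force (phi z t) t = dt (dt phi) z t + rho z t *: basis_vec R ord_max.
Proof.
move=> Oz Jt; have Dz := OD Oz; have It := JI Jt.
have [uE vE] := fields Oz Jt.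
rewrite /force -vE; congr (_ + _).
have [||_ ->] := @material_derivatives R n D I phi oD oI sphi _
    (dt phi) u Om J z t OD JI oO oJ Oz Jt (uphi Dz It).
- exact: (smooth_differentiable (open_spacetime oD oI) (smooth_dt sphi)).
- by move=> w s Ow Js; have [] := fields Ow Js.
- congr (_ + _); apply: eq_bigr => k _.
  by rewrite uE.
Qed.

Lemma force_gradientE z t : Om z -> J t ->
  force_gradient z t = dphi phi z t *m
    \matrix_(k, j) partial k (fun y => force y t 0 j) (phi z t).
Proof.
move=> Oz Jt; have Dz := OD Oz; have It := JI Jt.
have sacc j : smooth_on_spacetime D I (dt (dt (phi_ j))).
  exact: smooth_dt (smooth_dt (sphi_ j)).
apply/matrixP => i j; rewrite [RHS]mxE.
pose G w s := dt (dt (phi_ j)) w s + (j == ord_max)%:R * rho w s.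
have [||GE _] := @material_derivatives R n D I phi oD oI sphi _
    G (fun y s => force y s 0 j) Om J z t OD JI oO oJ Oz Jt (uphi Dz It).
- have -> : st G = st (dt (dt (phi_ j))) + (j == ord_max)%:R *: st rho by [].
  apply: differentiableD; first exact: differentiable_smooth (sacc j) Dz It.
  by apply: differentiableZ; exact: differentiable_smooth srho Dz It.
- move=> w s Ow Js; rewrite acceleration // !mxE /= /G.
  by rewrite mulrC [j == _]eq_sym (acceleration_coord j (OD Ow) (JI Js)).
- have -> : force_gradient z t i j = partial i (G^~ t) z.
    rewrite mxE /partial.
    have -> : G^~ t = (dt (dt (phi_ j)))^~ t + (j == ord_max)%:R *: rho^~ t by [].
    have d1 := smooth_derivable_space (sacc j) Dz It.
    have d2 := smooth_derivable_space srho Dz It.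
    rewrite deriveD //; last exact: derivableZ.
    by rewrite deriveZ.
  by rewrite GE; apply: eq_bigr => k _; congr (_ * _); rewrite mxE.
Qed.

End Fields.
End Equations.

(** The (a, b) component of the 2-form df /\ dg. *)
Definition wedge (R : realType) n (a b : 'I_n) (f g : 'rV[R]_n -> R -> R) z t : R :=
  partial a (f^~ t) z * partial b (g^~ t) z
  - partial b (f^~ t) z * partial a (g^~ t) z.

Lemma wedge_self (R : realType) n (a b : 'I_n) (f : 'rV[R]_n -> R -> R) z t :
  wedge a b f f z t = 0.
Proof. by rewrite /wedge mulrC subrr. Qed.

(** The exterior derivative of sum_j phi_j' d phi_j + rho d (int phi_n), that is the
    vorticity pulled back to material coordinates with its buoyancy correction.  Its
    components are those of h in dimensions 2 and 3. *)
Definition vorticity_form (R : realType) n (phi : 'rV[R]_n -> R -> 'rV[R]_n)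
    (rho intphi : 'rV[R]_n -> R -> R) (a b : 'I_n) z t : R :=
  \sum_j wedge a b (dt (Defs.coord j phi)) (Defs.coord j phi) z t
  + wedge a b rho intphi z t.

Lemma is_derive_minor (R : realType) (fa fb ga gb : R -> R)
    (dfa dfb dga dgb t : R) :
  is_derive t 1 fa dfa -> is_derive t 1 fb dfb ->
  is_derive t 1 ga dga -> is_derive t 1 gb dgb ->
  is_derive t 1 (fun s => fa s * gb s - fb s * ga s)
    (dfa * gb t - dfb * ga t + (fa t * dgb - fb t * dga)).
Proof.
move=> ha hb ka kb.
apply: is_derive_eq (is_deriveB (is_deriveM ha kb) (is_deriveM hb ka)) _.
have scaleE (x y : R) : x *: y = x * y by [].
by rewrite !scaleE; ring.
Qed.

(** * The criterion in arbitrary dimension *)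

Section Criterion.
Context {R : realType} {n : nat} {V : zmodType}.
Variable curl : ('rV[R]_n.+1 -> 'rV[R]_n.+1) -> 'rV[R]_n.+1 -> V.
Hypothesis curlP : forall F x, curl F x = 0 <->
  forall a b, partial a (fun y => F y 0 b) x = partial b (fun y => F y 0 a) x.
Variables (D : set 'rV[R]_n.+1) (I : set R).
Variables (phi : 'rV[R]_n.+1 -> R -> 'rV[R]_n.+1).
Variables (rho intphi : 'rV[R]_n.+1 -> R -> R).
Hypothesis oD : open D.
Hypothesis iI : open_interval I.
Hypothesis sphi : smooth_on_spacetime D I phi.
Hypothesis srho : smooth_on_spacetime D I rho.
Hypothesis antiphi : last_antiderivative D I phi intphi.

Let oI : open I. Proof. by case: iI. Qed.
Local Notation phi_ j := (Defs.coord j phi).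
Let sphi_ j : smooth_on_spacetime D I (phi_ j) :=
  smooth_coordinate oD oI j sphi.

(** Each of the three equations at phi z t corresponds to one conjunct.  The third
    one is the vanishing of M (K - K^T) M^T, with K the gradient of the force. *)
Lemma euler_boussinesq_atP Om J u vrho z t :
  Om `<=` D -> J `<=` I -> open Om -> open J ->
  (forall z t, D z -> I t -> dphi phi z t \in unitmx) ->
  determines_fields phi rho Om J u vrho -> Om z -> J t ->
  euler_boussinesq_at curl u vrho (phi z t) t <->
  [/\ dt (fun z t => \det (dphi phi z t)) z t = 0, dt rho z t = 0 &
    forall a b, \sum_j (force_gradient phi rho z t a j * dphi phi z t b j
                 - force_gradient phi rho z t b j * dphi phi z t a j) = 0].
Proof.
move=> OD JI oO oJ uphi fields Oz Jt; have Dz := OD z Oz; have It := JI t Jt.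
rewrite (divergence_det oD oI sphi OD JI oO oJ uphi fields Oz Jt).
rewrite (density_transport oD oI sphi srho OD JI oO oJ uphi fields Oz Jt).
rewrite (force_gradientE oD oI sphi srho OD JI oO oJ uphi fields Oz Jt).
pose force y := dt u y t + convection u y t + vrho y t *: basis_vec R ord_max.
have curl0 : curl force (phi z t) = 0 <->
    forall a b, \sum_j (
      (dphi phi z t *m \matrix_(k, j) partial k (fun y => force y 0 j) (phi z t)) a j
        * dphi phi z t b j -
      (dphi phi z t *m \matrix_(k, j) partial k (fun y => force y 0 j) (phi z t)) b j
        * dphi phi z t a j) = 0.
  apply: iff_trans (curlP _ _) _.
  apply: iff_trans _ (iff_sym (antisymmetric_part_eq0 _ (uphi z t Dz It))).
  by split=> h a b; have := h a b; rewrite !mxE.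
have det0 : \det (dphi phi z t) != 0 by rewrite -unitfE -unitmxE uphi.
split=> [[d0 c0 r0]|[d0 r0 c0]]; split.
- by rewrite d0 mulr0.
- by [].
- exact/curl0.
- by move/eqP: d0; rewrite mulf_eq0 (negbTE det0) => /eqP.
- exact/curl0.
- by [].
Qed.

Lemma is_derive_wedge f g a b z t :
  smooth_on_spacetime D I f -> smooth_on_spacetime D I g -> D z -> I t ->
  is_derive t 1 (wedge a b f g z)
    (wedge a b (dt f) g z t + wedge a b f (dt g) z t).
Proof.
move=> sf sg Dz It.
have df i := is_derive_partial oD oI sf i Dz It.
have dg i := is_derive_partial oD oI sg i Dz It.
exact: is_derive_minor (df a) (df b) (dg a) (dg b).
Qed.

(** The terms dphi_j' /\ dphi_j' vanish, and so does d rho' /\ d int phi_n; the time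
    derivative of int phi_n turns d rho /\ d int phi_n into d rho /\ d phi_n, which
    is the buoyancy part of the force gradient. *)
Lemma is_derive_vorticity_form a b z t : D z -> I t ->
  (forall y, D y -> dt rho y t = 0) ->
  is_derive t 1 (vorticity_form phi rho intphi a b z)
    (\sum_j (force_gradient phi rho z t a j * dphi phi z t b j
             - force_gradient phi rho z t b j * dphi phi z t a j)).
Proof.
move=> Dz It rho0; have [sint intE] := antiphi.
have Dn : \forall y \near z, D y by exact: open_nbhs_nbhs.
have rho'0 i : partial i ((dt rho)^~ t) z = 0.
  rewrite /partial -(@derive_cst R _ _ (0 : R) z (basis_vec R i)).
  by apply: near_eq_derive; apply: filterS Dn => y /rho0.
have int' i : partial i ((dt intphi)^~ t) z = partial i ((phi_ ord_max)^~ t) z.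
  by apply: near_eq_derive; apply: filterS Dn => y Dy; exact: intE.
have dsum : is_derive t 1 (\sum_(j < n.+1) wedge a b (dt (phi_ j)) (phi_ j) z) _ :=
  is_derive_sum (fun j => is_derive_wedge a b (smooth_dt (sphi_ j)) (sphi_ j) Dz It).
have -> : vorticity_form phi rho intphi a b z =
    (\sum_(j < n.+1) wedge a b (dt (phi_ j)) (phi_ j) z) + wedge a b rho intphi z.
  by apply/funext => s; rewrite /vorticity_form -[RHS]/(_ + _) fct_sumE.
apply: is_derive_eq (is_deriveD dsum (is_derive_wedge a b srho sint Dz It)) _.
have -> : wedge a b (dt rho) intphi z t = 0 by rewrite /wedge !rho'0 !mul0r subrr.
have -> : wedge a b rho (dt intphi) z t
        = \sum_(j < n.+1) (j == ord_max)%:R * wedge a b rho (phi_ j) z t.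
  rewrite (bigD1 ord_max) //= eqxx mul1r big1 ?addr0; last first.
    by move=> j /negbTE ->; rewrite mul0r.
  by rewrite /wedge !int'.
rewrite add0r -big_split /=; apply: eq_bigr => j _.
have bilin (p q p' q' x y d : R) : p * y - q * x + d * (p' * y - q' * x)
    = (p + d * p') * y - (q + d * q') * x by ring.
by rewrite wedge_self addr0 !mxE; exact: bilin.
Qed.

Lemma injective_box z t : D z -> I t -> dphi phi z t \in unitmx ->
  exists Om J, [/\ open Om /\ Om `<=` D, open J /\ J `<=` I, Om z, J t &
    forall s, J s -> {in Om &, injective (phi^~ s)}].
Proof.
move=> Dz It uphi.
have inj := local_injectivity
  (smooth_strict (open_spacetime oD oI) sphi (conj Dz It : (D `*` I) (z, t)))
  (fun v => st_diff_space sphi v Dz It) uphi.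
have /nbhs_ballP[d /= d0 dD] : nbhs z D by exact: open_nbhs_nbhs.
have /nbhs_ballP[e /= e0 eI] : nbhs t I by exact: open_nbhs_nbhs.
near (0 : R)^'+ => r.
have r0 : 0 < r by [].
exists (ball z r), (ball t r); split.
- split; first exact: ball_open.
  apply: subset_trans dD; apply: le_ball; apply: ltW.
  by near: r; exact: nbhs_right_lt.
- split; first exact: ball_open.
  apply: subset_trans eI; apply: le_ball; apply: ltW.
  by near: r; exact: nbhs_right_lt.
- exact: ballxx.
- exact: ballxx.
- move=> s; rewrite -ball_normE /= distrC => sr y w.
  rewrite !inE -!ball_normE /= distrC [X in _ -> X < _ -> _]distrC => yr wr E.
  suff : forall z' w s, `|z' - z| < r -> `|w - z| < r -> `|s - t| < r ->
    st phi (z', s) = st phi (w, s) -> z' = w by move/(_ y w s); apply.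
  by near: r.
Unshelve. all: by end_near. Qed.

Lemma fields_exist (Om : set 'rV[R]_n.+1) (J : set R) :
  (forall s, J s -> {in Om &, injective (phi^~ s)}) ->
  exists u vrho, determines_fields phi rho Om J u vrho.
Proof.
move=> inj.
pose inv y s := get [set w | Om w /\ phi w s = y].
have invE w s : Om w -> J s -> inv (phi w s) s = w.
  move=> Ow Js; have [] : [set v | Om v /\ phi v s = phi w s] (inv (phi w s) s).
    by apply: getPex; exists w.
  by move=> Oi E; apply: (inj s Js _ _ _ _ E); rewrite inE.
exists (fun y s => dt phi (inv y s) s), (fun y s => rho (inv y s) s).
by move=> w s Ow Js; rewrite invE.
Qed.

(** Vanishing of the time derivatives at every point is constancy in time on the
    interval I.  From right to left the boxes are given; from left to right one is
    chosen around each point, where the fields exist by injectivity. *)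
Theorem solution_criterion :
  provides_solution curl D I phi rho <->
  [/\ forall z t, D z -> I t -> \det ('J (phi^~ t) z) != 0,
      time_independent D I (fun z t => \det ('J (phi^~ t) z)),
      time_independent D I rho
    & forall a b, time_independent D I (vorticity_form phi rho intphi a b)].
Proof.
have unitP : (forall z t, D z -> I t -> \det ('J (phi^~ t) z) != 0) ->
    forall z t, D z -> I t -> dphi phi z t \in unitmx.
  move=> h z t Dz It; rewrite unitmxE unitfE -(jacobianE oD oI sphi Dz It).
  exact: h.
have jacP : time_independent D I (fun z t => \det ('J (phi^~ t) z)) <->
    (forall z t, D z -> I t -> dt (fun z t => \det (dphi phi z t)) z t = 0).
  rewrite -(time_independentP iI); last first.
    move=> z t Dz It.
    exact: (@ex_derive _ _ _ _ _ _ _ (is_derive_det_dphi oD oI sphi Dz It)).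
  split=> h z Dz s t Is It; have := h z Dz s t Is It;
    by rewrite !(jacobianE oD oI sphi).
have rhoP : time_independent D I rho <->
    (forall z t, D z -> I t -> dt rho z t = 0).
  apply: time_independentP => // z t; exact: smooth_derivable_time.
have vortP : (forall z t, D z -> I t -> dt rho z t = 0) ->
    (forall a b, time_independent D I (vorticity_form phi rho intphi a b)) <->
    (forall z t, D z -> I t -> forall a b,
      \sum_j (force_gradient phi rho z t a j * dphi phi z t b j
        - force_gradient phi rho z t b j * dphi phi z t a j) = 0).
  move=> rho0.
  have dv a b z t (Dz : D z) (It : I t) :=
    is_derive_vorticity_form a b Dz It (fun y Dy => rho0 y t Dy It).
  have dvP a b := @time_independentP R _ D I (vorticity_form phi rho intphi a b) iI
    (fun z t Dz It => @ex_derive _ _ _ _ _ _ _ (dv a b z t Dz It)).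
  split=> [h z t Dz It a b|h a b].
    have := (dvP a b).1 (h a b) z t Dz It.
    by rewrite /dt derive1E (@derive_val _ _ _ _ _ _ _ (dv a b z t Dz It)).
  apply/dvP => z t Dz It.
  rewrite /dt derive1E (@derive_val _ _ _ _ _ _ _ (dv a b z t Dz It)).
  exact: h.
split=> [[det0 sol]|[det0 /jacP Hdet /rhoP Hrho Hv]].
  have uphi := unitP det0.
  have pt z t (Dz : D z) (It : I t) :
    [/\ dt (fun z t => \det (dphi phi z t)) z t = 0, dt rho z t = 0 &
      forall a b, \sum_j (force_gradient phi rho z t a j * dphi phi z t b j
                 - force_gradient phi rho z t b j * dphi phi z t a j) = 0].
    have [Om [J [[oO OD] [oJ JI] Oz Jt inj]]] := injective_box Dz It (uphi z t Dz It).
    have [u [vrho fields]] := fields_exist inj.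
    apply/(euler_boussinesq_atP OD JI oO oJ uphi fields Oz Jt).
    exact: (sol Om J).
  have rho0 z t (Dz : D z) (It : I t) : dt rho z t = 0.
    by have [_ h _] := pt z t Dz It; exact: h.
  split; [exact: det0|apply/jacP|exact/rhoP|apply/(vortP rho0)] => z t Dz It.
    by have [h _ _] := pt z t Dz It; exact: h.
  by have [_ _ h] := pt z t Dz It; exact: h.
split=> [|Om J oO OD oJ JI inj u vrho fields z t Oz Jt]; first exact: det0.
apply/(euler_boussinesq_atP OD JI oO oJ (unitP det0) fields Oz Jt).
have Dz := OD z Oz; have It := JI t Jt.
split; [exact: Hdet|exact: Hrho|].
exact: (vortP Hrho).1 Hv z t Dz It.
Qed.

End Criterion.

(** * Dimensions two and three *)

Lemma wedgeC (R : realType) n (a b : 'I_n) (f g : 'rV[R]_n -> R -> R) z t :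
  wedge b a f g z t = - wedge a b f g z t.
Proof. by rewrite /wedge opprB. Qed.

Lemma vorticity_formC (R : realType) n (phi : 'rV[R]_n -> R -> 'rV[R]_n)
    (rho intphi : 'rV[R]_n -> R -> R) (a b : 'I_n) z t :
  vorticity_form phi rho intphi b a z t = - vorticity_form phi rho intphi a b z t.
Proof.
rewrite /vorticity_form opprD [wedge b a rho _ _ _]wedgeC; congr (_ + _).
by rewrite -sumrN; apply: eq_bigr => j _; rewrite wedgeC.
Qed.

Lemma vorticity_form_diag (R : realType) n (phi : 'rV[R]_n -> R -> 'rV[R]_n)
    (rho intphi : 'rV[R]_n -> R -> R) (a : 'I_n) z t :
  vorticity_form phi rho intphi a a z t = 0.
Proof.
rewrite /vorticity_form big1 => [|j _]; first by rewrite /wedge subrr addr0.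
by rewrite /wedge subrr.
Qed.

Lemma time_independent_vorticity_formC (R : realType) n (D : set 'rV[R]_n)
    (I : set R) (phi : 'rV[R]_n -> R -> 'rV[R]_n)
    (rho intphi : 'rV[R]_n -> R -> R) (a b : 'I_n) :
  time_independent D I (vorticity_form phi rho intphi a b) ->
  time_independent D I (vorticity_form phi rho intphi b a).
Proof.
move=> h z Dz s t Is It.
by rewrite ![vorticity_form _ _ _ b a _ _]vorticity_formC (h z Dz s t Is It).
Qed.

Lemma time_independent_vorticity_form_diag (R : realType) n (D : set 'rV[R]_n)
    (I : set R) (phi : 'rV[R]_n -> R -> 'rV[R]_n)
    (rho intphi : 'rV[R]_n -> R -> R) (a : 'I_n) :
  time_independent D I (vorticity_form phi rho intphi a a).
Proof. by move=> z _ s t _ _; rewrite !vorticity_form_diag. Qed.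

Lemma ord2P (a : 'I_2) : a = inord 0 \/ a = inord 1.
Proof.
by case: a => [[|[|]]] // i; [left|right]; apply/val_inj; rewrite /= inordK.
Qed.

Lemma ord3P (a : 'I_3) : [\/ a = inord 0, a = inord 1 | a = inord 2].
Proof.
by case: a => [[|[|[|]]]] // i; [constructor 1|constructor 2|constructor 3];
   apply/val_inj; rewrite /= inordK.
Qed.

Lemma curl2_eq0 (R : realType) (F : 'rV[R]_2 -> 'rV[R]_2) x :
  curl2 F x = 0 <->
  forall a b, partial a (fun y => F y 0 b) x = partial b (fun y => F y 0 a) x.
Proof.
rewrite /curl2; split=> [/subr0_eq h a b|h]; last by rewrite h subrr.
case: (ord2P a) => ->; case: (ord2P b) => ->;
  [exact: erefl|exact: h|exact: esym h|exact: erefl].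
Qed.

Lemma row3E (R : realType) (a b c : R) :
  [/\ row3 a b c 0 (inord 0) = a, row3 a b c 0 (inord 1) = b &
      row3 a b c 0 (inord 2) = c].
Proof. by split; rewrite mxE inordK. Qed.

Lemma row3_inj (R : realType) (a b c a' b' c' : R) :
  row3 a b c = row3 a' b' c' <-> [/\ a = a', b = b' & c = c'].
Proof.
split=> [E|[-> -> ->] //].
have [p0 p1 p2] := row3E a b c; have [q0 q1 q2] := row3E a' b' c'.
rewrite E in p0 p1 p2.
by split; [rewrite -p0|rewrite -p1|rewrite -p2].
Qed.

Lemma row3_0 (R : realType) : 0 = row3 0 0 0 :> 'rV[R]_3.
Proof. by apply/rowP => i; rewrite !mxE; case: (ord3P i) => ->; rewrite inordK. Qed.

Lemma row3D (R : realType) (a b c a' b' c' : R) :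
  row3 a b c + row3 a' b' c' = row3 (a + a') (b + b') (c + c').
Proof. by apply/rowP => i; rewrite !mxE; case: (ord3P i) => ->; rewrite inordK. Qed.

Lemma curl3_eq0 (R : realType) (F : 'rV[R]_3 -> 'rV[R]_3) x :
  curl3 F x = 0 <->
  forall a b, partial a (fun y => F y 0 b) x = partial b (fun y => F y 0 a) x.
Proof.
rewrite /curl3 row3_0; split=> [/row3_inj[] |h]; last first.
  by apply/row3_inj; split; rewrite h subrr.
move=> /subr0_eq e12 /subr0_eq e20 /subr0_eq e01 a b.
case: (ord3P a) => ->; case: (ord3P b) => ->;
  [exact: erefl|exact: e01|exact: esym e20|
   exact: esym e01|exact: erefl|exact: e12|
   exact: e20|exact: esym e12|exact: erefl].
Qed.

Lemma det_mx2 (R : comRingType) (A : 'M[R]_2) :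
  \det A = A 0 0 * A 1 1 - A 0 1 * A 1 0.
Proof.
rewrite (expand_det_row _ 0) !big_ord_recl big_ord0 addr0 /cofactor !det_mx11.
rewrite !mxE /= expr0 expr1 mul1r mulN1r mulrN.
have -> : lift 0 0 = 1 :> 'I_2 by exact: val_inj.
by have -> : lift 1 0 = 0 :> 'I_2 by exact: val_inj.
Qed.

Lemma det2_grad (R : realType) (f g : 'rV[R]_2 -> R -> R) z t :
  det2 (grad (f^~ t) z) (grad (g^~ t) z) = wedge (inord 0) (inord 1) f g z t.
Proof.
have i0 : inord 0 = 0 :> 'I_2 by apply/val_inj; rewrite /= inordK.
have i1 : inord 1 = 1 :> 'I_2 by apply/val_inj; rewrite /= inordK.
rewrite /det2 det_mx2 /wedge i0 i1.
have c0 j : (col_mx (grad (f^~ t) z) (grad (g^~ t) z) : 'M[R]_2) 0 j = partial j (f^~ t) z.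
  transitivity (grad (f^~ t) z 0 j); last by rewrite mxE.
  rewrite -(col_mxEu (grad (f^~ t) z) (grad (g^~ t) z)).
  by congr (fun_of_matrix _ _ _); exact: val_inj.
have c1 j : (col_mx (grad (f^~ t) z) (grad (g^~ t) z) : 'M[R]_2) 1 j = partial j (g^~ t) z.
  transitivity (grad (g^~ t) z 0 j); last by rewrite mxE.
  rewrite -(col_mxEd (grad (f^~ t) z) (grad (g^~ t) z)).
  by congr (fun_of_matrix _ _ _); exact: val_inj.
by rewrite !c0 !c1.
Qed.

Lemma h2E (R : realType) (phi : 'rV[R]_2 -> R -> 'rV[R]_2)
    (rho intphi : 'rV[R]_2 -> R -> R) z t :
  h2 phi rho intphi z t = vorticity_form phi rho intphi (inord 0) (inord 1) z t.
Proof.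
rewrite /h2 /vorticity_form det2_grad; congr (_ + _).
by apply: eq_bigr => j _; rewrite det2_grad.
Qed.

Lemma cross_grad (R : realType) (f g : 'rV[R]_3 -> R -> R) z t :
  cross (grad (f^~ t) z) (grad (g^~ t) z) =
  row3 (wedge (inord 1) (inord 2) f g z t) (wedge (inord 2) (inord 0) f g z t)
       (wedge (inord 0) (inord 1) f g z t).
Proof. by rewrite /cross !mxE. Qed.

Lemma h3E (R : realType) (phi : 'rV[R]_3 -> R -> 'rV[R]_3)
    (rho intphi : 'rV[R]_3 -> R -> R) z t :
  h3 phi rho intphi z t =
  row3 (vorticity_form phi rho intphi (inord 1) (inord 2) z t)
       (vorticity_form phi rho intphi (inord 2) (inord 0) z t)
       (vorticity_form phi rho intphi (inord 0) (inord 1) z t).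
Proof.
rewrite /h3 /vorticity_form cross_grad -[RHS]row3D; congr (_ + _).
apply/rowP => i; rewrite summxE mxE.
case: (ord3P i) => ->; rewrite inordK //=; apply: eq_bigr => j _;
  by rewrite cross_grad mxE inordK.
Qed.

Unset Implicit Arguments.
Theorem theorem2p1 (R : realType) :
  (forall (D : set 'rV[R]_2) (I : set R)
      (phi : 'rV[R]_2 -> R -> 'rV[R]_2) (rho intphi : 'rV[R]_2 -> R -> R),
    domain D -> open_interval I ->
    smooth_on_spacetime D I phi -> smooth_on_spacetime D I rho ->
    last_antiderivative D I phi intphi ->
    (provides_solution (@curl2 R) D I phi rho <->
     [/\ forall z t, D z -> I t -> \det ('J (phi^~ t) z) != 0,
         time_independent D I (fun z t => \det ('J (phi^~ t) z)),
         time_independent D I rho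
       & time_independent D I (h2 phi rho intphi)]))
  /\
  (forall (D : set 'rV[R]_3) (I : set R)
      (phi : 'rV[R]_3 -> R -> 'rV[R]_3) (rho intphi : 'rV[R]_3 -> R -> R),
    domain D -> open_interval I ->
    smooth_on_spacetime D I phi -> smooth_on_spacetime D I rho ->
    last_antiderivative D I phi intphi ->
    (provides_solution (@curl3 R) D I phi rho <->
     [/\ forall z t, D z -> I t -> \det ('J (phi^~ t) z) != 0,
         time_independent D I (fun z t => \det ('J (phi^~ t) z)),
         time_independent D I rho
       & time_independent D I (h3 phi rho intphi)])).
Proof.
split=> D I phi rho intphi [_ oD _] iI sphi srho anti.
- apply: iff_trans (solution_criterion (@curl2_eq0 R) oD iI sphi srho anti) _.
  have E : (forall a b, time_independent D I (vorticity_form phi rho intphi a b))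
      <-> time_independent D I (h2 phi rho intphi).
    split=> [h z Dz s t Is It|h]; first by rewrite !h2E; exact: h.
    have h01 : time_independent D I
        (vorticity_form phi rho intphi (inord 0) (inord 1)).
      by move=> z Dz s t Is It; rewrite -!h2E; exact: h.
    have h10 := time_independent_vorticity_formC h01.
    have diag a := @time_independent_vorticity_form_diag R _ D I phi rho intphi a.
    by move=> a b; case: (ord2P a) => ->; case: (ord2P b) => ->;
      [exact: diag|exact: h01|exact: h10|exact: diag].
  by split=> -[? ? ? /E ?].
- apply: iff_trans (solution_criterion (@curl3_eq0 R) oD iI sphi srho anti) _.
  have E : (forall a b, time_independent D I (vorticity_form phi rho intphi a b))
      <-> time_independent D I (h3 phi rho intphi).
    split=> [h z Dz s t Is It|h].
      by rewrite !h3E; apply/row3_inj; split; exact: h.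
    have h_eq z s t : D z -> I s -> I t -> _ :=
      fun Dz Is It => (row3_inj _ _ _ _ _ _).1 (etrans (esym (h3E phi rho intphi z s))
        (etrans (h z Dz s t Is It) (h3E phi rho intphi z t))).
    have h12 : time_independent D I
        (vorticity_form phi rho intphi (inord 1) (inord 2)).
      by move=> z Dz s t Is It; have [k _ _] := h_eq z s t Dz Is It; exact: k.
    have h20 : time_independent D I
        (vorticity_form phi rho intphi (inord 2) (inord 0)).
      by move=> z Dz s t Is It; have [_ k _] := h_eq z s t Dz Is It; exact: k.
    have h01 : time_independent D I
        (vorticity_form phi rho intphi (inord 0) (inord 1)).
      by move=> z Dz s t Is It; have [_ _ k] := h_eq z s t Dz Is It; exact: k.
    have h21 := time_independent_vorticity_formC h12.
    have h02 := time_independent_vorticity_formC h20.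
    have h10 := time_independent_vorticity_formC h01.
    have diag a := @time_independent_vorticity_form_diag R _ D I phi rho intphi a.
    by move=> a b; case: (ord3P a) => ->; case: (ord3P b) => ->;
      [exact: diag|exact: h01|exact: h02|
       exact: h10|exact: diag|exact: h12|
       exact: h20|exact: h21|exact: diag].
  by split=> -[? ? ? /E ?].
Qed.
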